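(* Let $A=(A_1,\dots,A_n)$ be a Hermitian tuple of $k\times k$ matrices (every $A_j$ is Hermitian), $n\ge2$. Then the spectral reducibility test for $A$ reaches a conclusion in no more than $\nu(A)-\kappa(A)$ steps.
   Context: **Characteristic polynomial, indices.** For a tuple $B=(B_1,\dots,B_N)$ of $k\times k$ matrices put $B_*(z)=z_1B_1+\cdots+z_NB_N$ and $Q_B(z_0,z)=\det(z_0I+B_*(z))$, with factorization $Q_B=\prod_{j=1}^sR_j(z_0,z)^{t_j}$ into powers of distinct irreducible polynomials. The spectral index is $\kappa(B)=s$ and the spectral multiplicity is $\nu(B)=t_1+\cdots+t_s$. $Q_B$ has repeated factors if some $t_j\ge2$. Here $B$ is called reducible if it has a nontrivial common reducing subspace; for Hermitian tuples this is the same as having a nontrivial common invariant subspace. Otherwise it is irreducible. **Admissibility.** Let $\sigma_p(B)=\{z\in\mathbb{C}^N:\det(I-B_*(z))=0\}$, with components $\Gamma_j=\{R_j(-1,z)=0\}$; let $p_B(z)=\prod_jR_j(-1,z)$, and let $L_i$ be the $i$-th complex coordinate line in $\mathbb{C}^N$. $B$ is admissible if $\frac{\partial p_B}{\partial z_i}(\lambda)\ne0$ for every $i$ and every $\lambda\in\sigma_p(B)\cap L_i$. For $D=(d_{is})\in GL(N,\mathbb{C})$ write $(DB)_i=\sum_sd_{is}B_s$; $D$ is admissible for $B$ if $DB$ is admissible and, when $B$ is Hermitian, $D$ is real. **Spectral stability.** Let $\widetilde B=(B_1,\dots,B_N,\dots,B_M)$ be an algebraic extension of an admissible tuple $B$ (the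 added matrices lie in the unital algebra generated by $B$), with $Q_{\widetilde B}=\prod_j\widetilde R_j^{t_j}$ its irreducible factorization. The extension $B\subset\widetilde B$ is spectrally stable if for every $1\le i\le N$ and every eigenvalue $\lambda$ of $B_i$, the point $\widetilde\tau\in\mathbb{C}^M$ with $i$-th coordinate $1/\lambda$ and all others $0$ lies on a single component $\{\widetilde R_m(-1,z)=0\}$ and $\frac{\partial}{\partial z_i}\widetilde R_m(-1,z)\neq0$ at $\widetilde\tau$. **Characteristic graph.** $\mathcal{G}_B$ is the directed graph on $\{1,\dots,k\}$ with an edge from $i$ to $j$ iff the $(i,j)$ entry of some $B_m$ is nonzero. It is strongly connected if for every pair of vertices $i,j$ there are directed paths from $i$ to $j$ and from $j$ to $i$. **Extensions.** For an admissible Hermitian tuple $B$, let $\lambda_1,\dots,\lambda_r$ be the distinct eigenvalues of $B_1$ and $\mathcal{P}_j$ the orthogonal projection onto the $\lambda_j$-eigenspace. For $1\le q\le r$, $I=(i_1,\dots,i_q)$ with $2\le i_1,\dots,i_q\le N$, and $J=(j_1,\dots,j_{q-1})$ with pairwise distinct entries in $\{1,\dots,r\}$ ($J=\emptyset$ if $q=1$), let $W_{IJ}=B_{i_1}\mathcal{P}_{j_1}B_{i_2}\mathcal{P}_{j_2}\cdots B_{i_{q-1}}\mathcal{P}_{j_{q-1}}B_{i_q}$. $\mathcal{A}_1(B)$ is the extension of $B$ that includes all these $W_{IJ}$ (for $q=1$ they are just $B_2,\dots,B_N$). For a tuple $\mathcal{B}$ invariant under adjoints, $\widetilde{\mathcal{B}}$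 is the Hermitian tuple obtained by keeping Hermitian entries and replacing each pair $(T,T^* )$ with $T\ne T^*$ by $\big(\frac12(T+T^* ),\frac i2(T-T^* )\big)$. For $j\ge2$, $\mathcal{A}_j(A)=\mathcal{A}_1\big(D_{j-1}\widetilde{\mathcal{A}_{j-1}(A)}\big)$, where $D_{j-1}$ is a chosen matrix close to the identity and admissible for $\widetilde{\mathcal{A}_{j-1}(A)}$. **The spectral reducibility test.** Without loss of generality (adding scalar multiples of the identity to the $A_j$, applying an admissible linear transformation to the tuple, and passing to a similar tuple), $A$ is taken to be an admissible Hermitian tuple of invertible matrices with $A_1$ diagonal. *Step 1.* Check whether $\mathcal{G}_A$ is strongly connected. If it is not, $A$ is reducible and the test stops. If $\mathcal{G}_A$ is strongly connected and $Q_A$ has no repeated factors, $A$ is irreducible and the test stops. If $\mathcal{G}_A$ is strongly connected and $Q_A$ has repeated factors, extend $A$ to $\mathcal{A}_1(A)$. If $Q_{\mathcal{A}_1(A)}$ has no repeated factors, $A$ is irreducible and the test stops. If $Q_{\mathcal{A}_1(A)}$ has repeated factors and the extension $A\subset\mathcal{A}_1(A)$ is spectrally stable, $A$ is reducible and the test stops. If $Q_{\mathcal{A}_1(A)}$ has repeated factors and the extension is not spectrally stable, pass to the next step. *Step $j$ ($j\ge2$).* Form $\mathcal{A}_j(A)$ and apply the operations of Step 1 to it, without the (now unnecessary) check of strong connectedness: if $Q_{\mathcal{A}_j(A)}$ has no repeated factors, $A$ is irreducible and the test stops; if it has repeated factors and the extension $\mathcal{A}_{j-1}(A)\subset\mathcal{A}_j(A)$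 (that is, $D_{j-1}\widetilde{\mathcal{A}_{j-1}(A)}\subset\mathcal{A}_j(A)$) is spectrally stable, $A$ is reducible and the test stops; otherwise pass to step $j+1$. *)

(* Defs.v *)
From mathcomp Require Import all_boot all_order all_algebra.
From mathcomp Require Import boolp.
From mathcomp Require Import mpoly.

Set Implicit Arguments.
Unset Strict Implicit.
Unset Printing Implicit Defensive.

Import Order.TTheory GRing.Theory Num.Theory.
Local Open Scope ring_scope.
Local Open Scope sesquilinear_scope.

(* A tuple (B_1, ..., B_N) of k x k complex matrices is a list B; its i-th     *)
(* entry is B`_(i - 1).  In the N.+1 variables of Q_B, z_0 is 'X_ord0 and z_i  *)
(* is 'X_(lift ord0 (i - 1)).                                                  *)

Section CharacteristicPolynomial.
Variables (C : numClosedFieldType) (k : nat).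
Implicit Types B : seq 'M[C]_k.

Definition char_mpoly B : {mpoly C[(size B).+1]} :=
  \det ('X_ord0 *: 1%:M +
        \sum_(i < size B) 'X_(lift ord0 i) *: map_mx (@mpolyC _ C) B`_i).

Definition mp_irreducible N (p : {mpoly C[N]}) : Prop :=
  [/\ p != 0, p \isn't a GRing.unit &
      forall q r, p = q * r -> q \is a GRing.unit \/ r \is a GRing.unit].

Definition e0 N (i : 'I_N.+1) : C := (i == ord0)%:R.

(* Since Q_B(1, 0) = 1, the irreducible factors of Q_B can be scaled to take   *)
(* the value 1 at (1, 0).  Scaled factors are associated only if they are      *)
(* equal, so that "distinct" is plain disequality.                             *)
Definition irr_factorization N (Q : {mpoly C[N.+1]})
    (f : seq ({mpoly C[N.+1]} * nat)) : Prop :=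
  [/\ uniq [seq Rt.1 | Rt <- f],
      forall Rt, Rt \in f ->
        [/\ mp_irreducible Rt.1, Rt.1.@[@e0 N] = 1 & (0 < Rt.2)%N] &
      Q = \prod_(Rt <- f) Rt.1 ^+ Rt.2].

Lemma irr_prod_exists N (p : {mpoly C[N.+1]}) : p.@[@e0 N] = 1 ->
  exists2 rs : seq {mpoly C[N.+1]},
    forall r, r \in rs -> mp_irreducible r /\ r.@[@e0 N] = 1 &
    p = \prod_(r <- rs) r.
Proof.
have [m] := ubnP (msize p); elim: m p => // m IHm p /ltnSE lepm p1.
have pn0 : p != 0.
  by apply/eqP => p0; move/eqP: p1; rewrite p0 meval0 eq_sym oner_eq0.
case: (boolP (p \is a GRing.unit)) => [pU|pNU].
  exists [::] => //; rewrite big_nil.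
  have /andP[/eqP pE _] : mpoly_unit p := pU.
  by move: p1; rewrite pE mevalC => ->.
have [|/existsNP[q /existsNP[r /not_implyP[pqr /not_orP[qU rU]]]]] :=
  pselect (forall q r, p = q * r -> q \is a GRing.unit \/ r \is a GRing.unit).
  by move=> irr; exists [:: p] => [r|]; rewrite ?big_seq1 // inE => /eqP->.
pose a := q.@[@e0 N]; pose b := r.@[@e0 N].
have ab1 : a * b = 1 by rewrite -mevalM -pqr.
have an0 : a != 0 by apply: contra_eq_neq ab1 => ->; rewrite mul0r eq_sym oner_eq0.
have bn0 : b != 0 by apply: contra_eq_neq ab1 => ->; rewrite mulr0 eq_sym oner_eq0.
have nU x : x != 0 -> x \isn't a GRing.unit ->
    (1 < msize (x : {mpoly C[N.+1]}))%N.
  move=> x0; apply: contraR; rewrite -leqNgt => /msize1_polyC xE.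
  move: x0; rewrite xE mpolyC_eq0 => x0.
  by apply/unitrP; exists (x@_0)^-1%:MP; rewrite -!mpolyCM mulVf ?divff.
have qn0 : q != 0 by apply: contraNneq an0 => q0; rewrite /a q0 meval0.
have rn0 : r != 0 by apply: contraNneq bn0 => r0; rewrite /b r0 meval0.
have sq := nU q qn0 (introN idP qU); have sr := nU r rn0 (introN idP rU).
have sp : msize p = (msize q + msize r).-1 by rewrite pqr msizeM.
have hs x c : (msize (c *: x : {mpoly C[N.+1]}) <= msize x)%N by apply: msizeZ_le.
have [||rs1 Hrs1 E1] := IHm (a^-1 *: q).
- apply: (leq_ltn_trans (hs _ _)); apply: leq_trans lepm.
  by rewrite sp; case: (msize r) sr => // -[|?] //= _; rewrite !addnS /= ltnS leq_addr.
- by rewrite mevalZ mulVf.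
have [||rs2 Hrs2 E2] := IHm (b^-1 *: r).
- apply: (leq_ltn_trans (hs _ _)); apply: leq_trans lepm.
  by rewrite sp; case: (msize q) sq => // -[|?] //= _; rewrite !addSn /= ltnS leq_addl.
- by rewrite mevalZ mulVf.
exists (rs1 ++ rs2) => [s|].
  by rewrite mem_cat => /orP[/Hrs1|/Hrs2].
by rewrite big_cat /= -E1 -E2 -scalerAl -scalerAr scalerA -invfM ab1 invr1 scale1r.
Qed.

Lemma char_mpoly_e0 B : (char_mpoly B).@[@e0 (size B)] = 1.
Proof.
rewrite /char_mpoly -det_map_mx -[RHS](det1 C k); congr (\det _).
apply/matrixP => i j; rewrite !mxE /= mevalD mevalM mevalXU /e0 eqxx mul1r.
rewrite summxE raddf_sum big1 /= => [|s _]; last first.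
  by rewrite mxE mevalM mevalXU /e0 -val_eqE /= mul0r.
by rewrite addr0; case: (i == j); rewrite ?meval1 ?meval0.
Qed.

Lemma irr_factorization_exists B :
  exists f, irr_factorization (char_mpoly B) f.
Proof.
have [rs irr_rs ->] := irr_prod_exists (char_mpoly_e0 B).
exists [seq (r, count_mem r rs) | r <- undup rs]; split.
- by rewrite -map_comp map_id undup_uniq.
- move=> _ /mapP[r + ->] /=; rewrite mem_undup => r_rs.
  have [irr_r r1] := irr_rs r r_rs.
  by split=> //; rewrite -has_count has_pred1.
rewrite big_map /= -(big_undup_iterop_count _ rs xpredT id).
exact: eq_bigr.
Qed.

Definition factors B : seq ({mpoly C[(size B).+1]} * nat) :=
  projT1 (cid (irr_factorization_exists B)).

Definition spectral_index B : nat := size (factors B).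

Definition spectral_multiplicity B : nat := \sum_(Rt <- factors B) Rt.2.

Definition repeated_factors B : bool := has (fun Rt => 2 <= Rt.2)%N (factors B).

End CharacteristicPolynomial.

Section Admissibility.
Variables (C : numClosedFieldType) (k : nat).
Implicit Types B : seq 'M[C]_k.

(* R(-1, z_1, ..., z_N) *)
Definition dehom N (R : {mpoly C[N.+1]}) : {mpoly C[N]} :=
  R \mPo [tuple oapp (fun j => 'X_j) (-1) (unlift ord0 i) | i < N.+1].

Definition in_spectrum B (z : 'I_(size B) -> C) : Prop :=
  \det (1%:M - \sum_(i < size B) z i *: B`_i) = 0.

Definition reduced_poly B : {mpoly C[size B]} :=
  \prod_(Rt <- factors B) dehom Rt.1.

Definition on_axis N (i : 'I_N) (z : 'I_N -> C) : Prop :=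
  forall j, j != i -> z j = 0.

Definition admissible B : Prop :=
  forall (i : 'I_(size B)) (z : 'I_(size B) -> C),
    in_spectrum z -> on_axis i z -> (mderiv i (reduced_poly B)).@[z] != 0.

Definition hermitian_tuple B : bool := all [pred M | M \is hermsymmx] B.

Definition lin_act B (D : 'M[C]_(size B)) : seq 'M[C]_k :=
  [seq \sum_(s < size B) D i s *: B`_s | i : 'I_(size B)].

Definition admissible_for B (D : 'M[C]_(size B)) : Prop :=
  [/\ D \in unitmx, admissible (lin_act D) &
      hermitian_tuple B -> D \is a realmx].

(* The components {R(-1, z) = 0} are indexed by the distinct factors R.  The   *)
(* point with i-th coordinate 1/lambda only exists for lambda <> 0, which is   *)
(* no restriction when B_i is invertible.                                      *)
Definition spectrally_stable B (Bt : seq 'M[C]_k) : Prop :=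
  forall (i : 'I_(size Bt)) (lambda : C),
    (i < size B)%N -> eigenvalue B`_i lambda -> lambda != 0 ->
    let tau := fun j => if j == i then lambda^-1 else 0 in
    exists R, [/\ R \in [seq Rt.1 | Rt <- factors Bt],
      (dehom R).@[tau] = 0,
      forall R', R' \in [seq Rt.1 | Rt <- factors Bt] ->
        (dehom R').@[tau] = 0 -> R' = R &
      (mderiv i (dehom R)).@[tau] != 0].

End Admissibility.

Section Extension.
Variables (C : numClosedFieldType) (k : nat).
Implicit Types (B : seq 'M[C]_k) (M : 'M[C]_k).

Definition distinct_eigenvalues M : seq C :=
  undup (sval (closed_field_poly_normal (char_poly M))).

(* Matrices act on row vectors here.  For Hermitian M the left and the right   *)
(* lambda-eigenspaces are conjugate to each other, and this is the matrix of   *)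
(* the orthogonal projection onto {v | M v = lambda v} on column vectors.      *)
Definition eigenprojection M (lambda : C) : 'M[C]_k :=
  proj_ortho (eigenspace M lambda).

(* W_{IJ} for I = (i_1, ..., i_q), listed by 0-based positions in B, and       *)
(* J = (j_1, ..., j_(q-1)), listed by the corresponding eigenvalues of B_1.    *)
Definition word B (I : seq nat) (J : seq C) : 'M[C]_k :=
  foldl (fun W ji => W *m eigenprojection B`_0 ji.1 *m B`_ji.2)
        B`_(head 0%N I) (zip J (behead I)).

(* All W_{IJ} for a given q.  The condition 2 <= i_s excludes position 0.      *)
Definition words B (q : nat) : seq 'M[C]_k :=
  let ev := distinct_eigenvalues B`_0 in
  let Is := [seq s : q.-tuple _ <- enum {: q.-tuple 'I_(size B)} |
              all (fun i : 'I_(size B) => 0 < i)%N s] in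
  let Js := [seq t : q.-1.-tuple _ <- enum {: q.-1.-tuple 'I_(size ev)} |
              uniq t] in
  [seq word B (map val (tval s)) [seq ev`_(val j) | j <- tval t]
     | s <- Is, t <- Js].

(* A_1(B): the words with q = 1 are B_2, ..., B_N, already present in B, so    *)
(* that q = 2, ..., r are added, r being the number of eigenvalues of B_1.     *)
Definition ext1 B : seq 'M[C]_k :=
  B ++ flatten [seq words B q
                 | q <- iota 2 (size (distinct_eigenvalues B`_0)).-1].

(* H is a Hermitian tuple obtained from B: the non-Hermitian entries of B,     *)
(* counted with multiplicity, are split into pairs (T, T^* ), with T in ts.    *)
Definition hermitization B (H : seq 'M[C]_k) : Prop :=
  exists2 ts : seq 'M[C]_k,
    perm_eq [seq T <- B | T \isn't hermsymmx] (ts ++ [seq T^t* | T <- ts]) &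
    H = [seq T <- B | T \is hermsymmx] ++
        flatten [seq [:: 2^-1 *: (T + T^t*); ('i / 2) *: (T - T^t*)] | T <- ts].

Definition char_graph B : rel 'I_k := fun i j => has (fun M => M i j != 0) B.

Definition strongly_connected B : bool :=
  [forall i, forall j, connect (char_graph B) i j
                       && connect (char_graph B) j i].

End Extension.

Section Test.
Variables (C : numClosedFieldType) (k : nat) (eps : C).
Implicit Types A B : seq 'M[C]_k.

Definition near_identity (N : nat) (D : 'M[C]_N) : Prop :=
  forall i j, `|D i j - (1%:M : 'M[C]_N) i j| < eps.

Inductive verdict := Reducible | Irreducible.

(* The part of Step 1 that precedes the formation of A_1(A). *)
Definition initial_verdict A (v : verdict) : Prop :=
  match v with
  | Reducible => ~~ strongly_connected A
  | Irreducible => strongly_connected A && ~~ repeated_factors A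
  end.

(* The step which forms the extension A_1(B): Step 1 for B = A, and Step j     *)
(* for B = D_(j-1) applied to the Hermitized A_(j-1)(A), so that A_1(B) is     *)
(* A_j(A).                                                                     *)
Definition step_verdict B (v : verdict) : Prop :=
  match v with
  | Reducible => repeated_factors (ext1 B) /\ spectrally_stable B (ext1 B)
  | Irreducible => ~~ repeated_factors (ext1 B)
  end.

Definition next_tuple B B' : Prop :=
  exists H, hermitization (ext1 B) H /\
  exists D, [/\ near_identity D, admissible_for D & B' = @lin_act C k H D].

(* Starting with the extension of B, at most m steps are carried out whatever  *)
(* choices are made, a choice is always possible when another step is needed,  *)
(* and the last step gives a verdict.                                          *)
Fixpoint steps_conclude (m : nat) B : Prop :=
  if m is m'.+1 then
    (exists v, step_verdict B v) \/
    (exists B', next_tuple B B') /\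
    (forall B', next_tuple B B' -> steps_conclude m' B')
  else False.

(* A verdict of the initial checks involves no extension and counts as 0       *)
(* steps.                                                                      *)
Definition test_concludes (m : nat) A : Prop :=
  (exists v, initial_verdict A v) \/ steps_conclude m A.

Definition shift A (c : 'I_(size A) -> C) : seq 'M[C]_k :=
  [seq A`_i + (c i)%:M | i : 'I_(size A)].

Definition normalized A : Prop :=
  [/\ hermitian_tuple A, admissible A, all [pred M | M \in unitmx] A &
      is_diag_mx A`_0].

(* The reductions made without loss of generality before the test starts. *)
Definition normalization A A' : Prop :=
  normalized A' /\
  exists (c : 'I_(size A) -> C) (D : 'M[C]_(size (shift c))) (S : 'M[C]_k),
    [/\ forall i, c i \is Num.real, admissible_for D, S \in unitmx &
        A' = [seq invmx S *m M *m S | M <- lin_act D]].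

Definition reducibility_test_concludes (m : nat) A : Prop :=
  (exists A', normalization A A') /\
  (forall A', normalization A A' -> test_concludes m A').

End Test.

(* Main.v *)
(* Write nu - kappa for the defect of a tuple.  If every B_i is, up to
   similarity and the addition of scalars, a linear combination of the matrices
   of Bt, then Q_B arises from Q_Bt by a linear substitution, the irreducible
   factors of Q_Bt become products of irreducible factors of Q_B, and unique
   factorization gives nu(Bt) - kappa(Bt) <= nu(B) - kappa(B).  If the two sides
   are equal, the product of the distinct factors of Q_Bt goes to that of Q_B.
   For an extension Bt of an admissible B, equality thus transports the
   simplicity of the zeros on the axes and makes the extension spectrally stable.
   So every step without a verdict lowers the defect, while Hermitization, linear
   transformations and the normalization do not raise it.  Admissible matrices
   close to the identity exist because the squarefree part of Q_B is coprime to
   its z_0-derivative over the field of fractions of C[z], hence also after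
   specialization to a generic real direction z. *)

From HB Require Import structures.
Require Import Defs.
From mathcomp Require Import all_boot all_order all_algebra.
From mathcomp Require Import reals complex boolp mpoly ring.
Import Order.TTheory GRing.Theory Num.Theory.
Local Open Scope ring_scope.
Local Open Scope sesquilinear_scope.

Set Implicit Arguments.
Unset Strict Implicit.
Unset Printing Implicit Defensive.

Section Factoriality.
Variable D : idomainType.
Implicit Types (a b c x y : D) (p q f g : {poly D}).

Definition irreducible_elt x : Prop :=
  [/\ x != 0, x \isn't a GRing.unit &
      forall y z, x = y * z -> y \is a GRing.unit \/ z \is a GRing.unit].

Definition elt_dvd x y : Prop := exists z, y = x * z.

Definition prime_elt x : Prop :=
  [/\ x != 0, x \isn't a GRing.unit &
      forall y z, elt_dvd x (y * z) -> elt_dvd x y \/ elt_dvd x z].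

Definition factorial : Prop := forall c, c != 0 ->
  exists u s, [/\ u \is a GRing.unit, forall x, x \in s -> prime_elt x &
                  c = u * \prod_(x <- s) x].

(* If c divides p q coefficientwise, it divides the product of the leading
   coefficients, so that one of the two leading terms can be dropped. *)
Lemma prime_dvd_polyM c p q : prime_elt c ->
  (exists r, p * q = c *: r) -> (exists p', p = c *: p') \/ (exists q', q = c *: q').
Proof.
move=> [c0 _ cP].
have [n] := ubnP (size p + size q); elim: n p q => // n IHn p q /ltnSE le_n [r pq].
have [->|p0] := eqVneq p 0; first by left; exists 0; rewrite scaler0.
have [->|q0] := eqVneq q 0; first by right; exists 0; rewrite scaler0.
have split_lead (f : {poly D}) : f != 0 ->
    exists2 f1, f - lead_coef f *: 'X ^+ (size f).-1 = f1 & (size f1 < size f)%N.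
  move=> f0; exists (\poly_(i < (size f).-1) f`_i); last first.
    by rewrite (leq_ltn_trans (size_poly _ _)) // ltn_predL lt0n size_poly_eq0.
  rewrite -[f in f - _]coefK /lead_coef !poly_def -[size f]prednK.
    by rewrite big_ord_recr /= addrK.
  by rewrite lt0n size_poly_eq0.
have /cP[[y E]|[y E]] : elt_dvd c (lead_coef p * lead_coef q).
  by exists (lead_coef r); rewrite -lead_coefM pq lead_coefZ.
- have [p1 pE sp] := split_lead p p0.
  have [||[p2 p2E]|] := IHn p1 q; last by right.
  + by apply: leq_trans le_n; rewrite ltn_add2r.
  + exists (r - y *: 'X ^+ (size p).-1 * q).
    rewrite scalerBr -pq -scalerAl scalerA -E scalerAl -mulrBl.
    by rewrite pE.
  by left; exists (p2 + y *: 'X ^+ (size p).-1);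
    rewrite scalerDr scalerA -E -p2E -pE subrK.
- have [q1 qE sq] := split_lead q q0.
  have [|||[q2 q2E]] := IHn p q1; [| |by left|].
  + by apply: leq_trans le_n; rewrite ltn_add2l.
  + exists (r - y *: 'X ^+ (size q).-1 * p).
    rewrite -qE mulrBr pq scalerBr -scalerAl scalerA -E.
    by rewrite mulrC -scalerAl.
  by right; exists (q2 + y *: 'X ^+ (size q).-1);
    rewrite scalerDr scalerA -E -q2E -qE subrK.
Qed.

Hypothesis factD : factorial.

Lemma scale_cancel c p q g : c != 0 -> c *: p = q * g ->
  exists a b q1 g1, [/\ q = a *: q1, g = b *: g1 & p = q1 * g1].
Proof.
move=> /factD[u [s [uU sP ->]]]; elim: s sP q g => [|x s IHs] sP q g.
  rewrite big_nil mulr1 => E; exists u, 1, (u^-1 *: q), g.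
  rewrite scale1r scalerA divrr // scale1r -scalerAl -E scalerA mulVr //.
  by rewrite scale1r.
rewrite big_cons mulrCA -scalerA => E.
have xP : prime_elt x by apply: sP; rewrite mem_head.
have x0 : x != 0 by case: xP.
have sP' y : y \in s -> prime_elt y by move=> ys; apply: sP; rewrite inE ys orbT.
have canx f g' : x *: f = x *: g' -> f = g'.
  move/eqP; rewrite -subr_eq0 -scalerBr scale_poly_eq0 (negPf x0) /=.
  by rewrite subr_eq0 => /eqP.
have [|[q' qE]|[g' gE]] := prime_dvd_polyM (p := q) (q := g) xP.
- by exists (u * \prod_(j <- s) j *: p).
- move: E; rewrite qE -scalerAl => /canx /(IHs sP')[a [b [q1 [g1 [-> -> ->]]]]].
  by exists (x * a), b, q1, g1; rewrite scalerA.
- move: E; rewrite gE -scalerAr => /canx /(IHs sP')[a [b [q1 [g1 [-> -> ->]]]]].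
  by exists a, (x * b), q1, g1; rewrite scalerA.
Qed.

End Factoriality.

Section GaussLemma.
Variable D : idomainType.
Implicit Types (p q f g : {poly D}).
Hypothesis factD : factorial D.

(* gcdp, coprimep and %| over an integral domain are those of its fraction field,
   up to nonzero constants; scale_cancel removes the constants. *)
Lemma irreducible_coprime_or_dvd p f : irreducible_elt p -> (1 < size p)%N ->
  coprimep p f \/ elt_dvd p f.
Proof.
move=> [p0 pU pI] sp; set g := gcdp p f.
have /Pdiv.Idomain.dvdpP[[c q] /= c0 cE] : g %| p := dvdp_gcdl p f.
have [a [b [q1 [g1 [qE gE pE]]]]] := scale_cancel factD c0 cE.
have size_unit (h : {poly D}) : h \is a GRing.unit -> size h = 1%N.
  by rewrite poly_unitE => /andP[/eqP].
have g0 : g != 0 by rewrite /g gcdp_eq0 (negPf p0).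
have b0 : b != 0 by apply: contraNneq g0 => b0; rewrite gE b0 scale0r.
case: (pI _ _ pE) => [q1U|/size_unit sg1]; last first.
  by left; rewrite coprimep_def -/g gE size_scale // sg1.
right; have /Pdiv.Idomain.dvdpP[[c2 q2] /= c20 c2E] : g %| f := dvdp_gcdr p f.
have gE' : g = b *: q1^-1 * p by rewrite gE -scalerAl pE mulKr.
have E : c2 *: f = q2 * (b *: q1^-1) * p by rewrite c2E gE' mulrA.
have [a' [b' [w1 [p1 [_ pE' ->]]]]] := scale_cancel factD c20 E.
have := pI b'%:P p1; rewrite mul_polyC => /(_ pE') [b'U|/size_unit sp1].
  exists (w1 * b'%:P^-1).
    rewrite [RHS]mulrC -mulrA. congr (_ * _).
    by rewrite pE' -mul_polyC mulKr.
have := size_scale_leq b' p1; rewrite -pE' sp1 => /(leq_trans sp).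
by rewrite ltnn.
Qed.

Lemma polyC_unit (x : D) : (x%:P \is a GRing.unit) = (x \is a GRing.unit).
Proof.
rewrite poly_unitE coefC /= size_polyC.
by have [->|] := eqVneq x 0; rewrite ?unitr0.
Qed.

Lemma prime_polyC (x : D) : prime_elt x -> prime_elt x%:P.
Proof.
move=> xP; have [x0 xU _] := xP; split; rewrite ?polyC_eq0 ?polyC_unit //.
move=> f g [r]; rewrite mul_polyC => E.
have [|[f' ->]|[g' ->]] := prime_dvd_polyM (p := f) (q := g) xP; first by exists r.
- by left; exists f'; rewrite mul_polyC.
- by right; exists g'; rewrite mul_polyC.
Qed.

Lemma prime_mulU (E : idomainType) (x u : E) :
  u \is a GRing.unit -> prime_elt x -> prime_elt (u * x).
Proof.
move=> uU [x0 xU xP]; split.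
  by rewrite mulf_neq0 //; apply: contraTneq uU => ->; rewrite unitr0.
  by rewrite unitrMr.
have dvdE y : elt_dvd x y -> elt_dvd (u * x) y.
  by move=> [z ->]; exists (u^-1 * z); rewrite mulrACA divrr // mul1r.
move=> y z [w E']; have [|/dvdE|/dvdE] := xP y z; [|by left|by right].
by exists (u * w); rewrite E' mulrCA mulrA.
Qed.

Lemma irreducible_prime_poly p : irreducible_elt p -> prime_elt p.
Proof.
move=> pI; have [p0 pU pI'] := pI; have [sp|sp] := leqP (size p) 1.
  have [x xE] : exists x, p = x%:P by exists p`_0; apply: size1_polyC.
  have x0 : x != 0 by rewrite -polyC_eq0 -xE.
  have [u [s [uU sP xsE]]] := factD x0.
  case: s sP xsE => [|y s] sP xsE.
    by move: pU; rewrite xE polyC_unit xsE big_nil mulr1 uU.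
  have yP := prime_polyC (sP y (mem_head _ _)).
  have yU : y%:P \isn't a GRing.unit by case: yP.
  have E : p = (u * \prod_(j <- s) j)%:P * y%:P.
    by rewrite -polyCM xE xsE big_cons; congr _%:P; ring.
  have [tU|] := pI' _ _ E; last by rewrite (negPf yU).
  by rewrite E; apply: prime_mulU.
split=> // f g [w fgE].
have [cop|] := irreducible_coprime_or_dvd f pI sp; last by left.
right; have /Bezout_coprimepP[[a b] /eqpP[[c1 c2] /= /andP[c10 c20] E]] := cop.
have E' : c2 *: g = (c1 *: (a * g + b * w)) * p.
  rewrite -[c2 *: g]mul1r -scalerCA -E.
  rewrite -!mul_polyC; ring: fgE.
have [a' [b' [w1 [p1 [_ pE' ->]]]]] := scale_cancel factD c20 E'.
have [] := pI' b'%:P p1; first by rewrite mul_polyC.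
  move=> b'U; exists (w1 * b'%:P^-1).
    rewrite [RHS]mulrC -mulrA. congr (_ * _).
    by rewrite pE' -mul_polyC mulKr.
rewrite poly_unitE => /andP[/eqP sp1 _].
have := size_scale_leq b' p1; rewrite -pE' sp1 => /(leq_trans sp).
by rewrite ltnn.
Qed.

End GaussLemma.

Section RingIsomorphism.
Variables (A B : idomainType) (f : {rmorphism A -> B}) (g : {rmorphism B -> A}).
Hypotheses (fK : cancel f g) (gK : cancel g f).

Lemma rmorph_iso_unit x : (f x \is a GRing.unit) = (x \is a GRing.unit).
Proof. by apply/idP/idP => [/(rmorph_unit g)|/(rmorph_unit f)] //; rewrite fK. Qed.

Lemma rmorph_iso_irreducible x : irreducible_elt x -> irreducible_elt (f x).
Proof.
move=> [x0 xU xI]; split; rewrite ?rmorph_iso_unit //.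
  by apply: contraNneq x0 => fx0; rewrite -(fK x) fx0 rmorph0.
move=> y z /(congr1 g); rewrite fK rmorphM => /xI.
by rewrite -!rmorph_iso_unit !gK.
Qed.

Lemma rmorph_iso_prime x : prime_elt (f x) -> prime_elt x.
Proof.
move=> [x0 xU xP]; split; first by apply: contraNneq x0 => ->; rewrite rmorph0.
  by rewrite -rmorph_iso_unit.
have dvdE y : elt_dvd (f x) (f y) -> elt_dvd x y.
  by move=> [z /(congr1 g)]; rewrite rmorphM !fK => ->; exists (g z).
move=> y z [w E]; have [|/dvdE|/dvdE] := xP (f y) (f z); [|by left|by right].
by exists (f w); rewrite -!rmorphM E.
Qed.

End RingIsomorphism.

Section MpolyMorphism.
Variables (n : nat) (C : comNzRingType) (S : comNzRingType).

Lemma mpoly_rmorph_ext (f g : {rmorphism {mpoly C[n]} -> S}) :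
  (forall c, f c%:MP = g c%:MP) -> (forall i, f 'X_i = g 'X_i) -> f =1 g.
Proof.
move=> eqC eqX p; rewrite [p]mpolyE !rmorph_sum; apply: eq_bigr => m _.
rewrite -mul_mpolyC !rmorphM eqC mpolyXE_id !rmorph_prod; congr (_ * _).
by apply: eq_bigr => i _; rewrite !rmorphXn eqX.
Qed.

Lemma mmapXU (f : {rmorphism C -> S}) (h : 'I_n -> S) i : mmap f h 'X_i = h i.
Proof. by rewrite mmapX mmap1U. Qed.

End MpolyMorphism.

Section FirstVariable.
Variables (n : nat) (C : comNzRingType).

Definition uni0 : {mpoly C[n.+1]} -> {poly {mpoly C[n]}} :=
  mmap (polyC \o @mpolyC n C)
    (fun i => oapp (fun j => ('X_j : {mpoly C[n]})%:P) 'X (unlift ord0 i)).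

Definition multi0 : {poly {mpoly C[n]}} -> {mpoly C[n.+1]} :=
  horner_eval 'X_ord0
    \o map_poly (comp_mpoly [tuple 'X_(lift ord0 j) : {mpoly C[n.+1]} | j < n]).

HB.instance Definition _ := GRing.RMorphism.on uni0.
HB.instance Definition _ := GRing.RMorphism.on multi0.

Lemma uni0C c : uni0 c%:MP = c%:MP%:P.
Proof. by rewrite /uni0 mmapC. Qed.

Lemma uni0X0 : uni0 'X_ord0 = 'X.
Proof. by rewrite /uni0 mmapXU unlift_none. Qed.

Lemma uni0XS j : uni0 'X_(lift ord0 j) = ('X_j)%:P.
Proof. by rewrite /uni0 mmapXU liftK. Qed.

Lemma multi0C c : multi0 c%:P = c \mPo [tuple 'X_(lift ord0 j) | j < n].
Proof. by rewrite /multi0 /= map_polyC /horner_eval hornerC. Qed.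

Lemma multi0X : multi0 'X = 'X_ord0.
Proof. by rewrite /multi0 /= map_polyX /horner_eval hornerX. Qed.

Lemma multi0XS j : multi0 ('X_j)%:P = 'X_(lift ord0 j).
Proof. by rewrite multi0C comp_mpolyXU -tnth_nth tnth_mktuple. Qed.

Lemma uni0K : cancel uni0 multi0.
Proof.
apply: (mpoly_rmorph_ext (f := multi0 \o uni0) (g := idfun)) => [c|i] /=.
  by rewrite uni0C multi0C comp_mpolyC.
by case: (unliftP ord0 i) => [j|] ->; rewrite ?uni0XS ?uni0X0 ?multi0X ?multi0XS.
Qed.

Lemma multi0K : cancel multi0 uni0.
Proof.
move=> p; have mC c : uni0 (multi0 c%:P) = c%:P.
  apply: (mpoly_rmorph_ext (f := uni0 \o multi0 \o polyC) (g := polyC)) => [d|i] /=.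
    by rewrite multi0C comp_mpolyC uni0C.
  by rewrite multi0XS uni0XS.
elim/poly_ind: p => [|p c IH]; first by rewrite !rmorph0.
by rewrite !rmorphD !rmorphM /= mC IH multi0X uni0X0.
Qed.

End FirstVariable.

Section MpolyFactorial.
Variable C : numClosedFieldType.

Lemma uni0_irreducible n (p : {mpoly C[n.+1]}) :
  irreducible_elt p -> irreducible_elt (uni0 p).
Proof.
exact: (rmorph_iso_irreducible (A := {mpoly C[n.+1]}) (B := {poly {mpoly C[n]}})
          (f := @uni0 n C) (g := @multi0 n C) (@uni0K n C) (@multi0K n C)).
Qed.

Lemma uni0_prime n (p : {mpoly C[n.+1]}) : prime_elt (uni0 p) -> prime_elt p.
Proof.
exact: (rmorph_iso_prime (A := {mpoly C[n.+1]}) (B := {poly {mpoly C[n]}})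
          (f := @uni0 n C) (g := @multi0 n C) (@uni0K n C)).
Qed.

Lemma mpoly_nonunit_msize n (x : {mpoly C[n]}) :
  x != 0 -> x \isn't a GRing.unit -> (1 < msize x)%N.
Proof.
move=> x0; apply: contraR; rewrite -leqNgt => /msize1_polyC xE.
move: x0; rewrite xE mpolyC_eq0 => x0.
by apply/unitrP; exists (x@_0)^-1%:MP; rewrite -!mpolyCM mulVf ?divff.
Qed.

Lemma mpoly_atomic n (p : {mpoly C[n]}) : p != 0 ->
  exists u s, [/\ u \is a GRing.unit, forall x, x \in s -> irreducible_elt x &
                  p = u * \prod_(x <- s) x].
Proof.
have [m] := ubnP (msize p); elim: m p => // m IHm p /ltnSE lepm p0.
have [pU|pU] := boolP (p \is a GRing.unit).
  by exists p, [::]; rewrite big_nil mulr1.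
have [pI|] := pselect (irreducible_elt p).
  exists 1, [:: p]; rewrite unitr1 big_seq1 mul1r; split=> // x.
  by rewrite inE => /eqP->.
move=> pNI; have [q [r [pE qU rU]]] :
    exists q r, [/\ p = q * r, q \isn't a GRing.unit & r \isn't a GRing.unit].
  apply: contrapT => pN; apply: pNI; split=> // q r pE.
  apply: contrapT => /not_orP[/negP qU /negP rU].
  by apply: pN; exists q, r.
have [q0 r0] : q != 0 /\ r != 0 by apply/andP; rewrite -negb_or -mulf_eq0 -pE.
have := mpoly_nonunit_msize q0 qU; have := mpoly_nonunit_msize r0 rU.
move: lepm; rewrite pE msizeM // => lepm sr sq.
have split_lt a b :
    ((a + b).-1 <= m -> 1 < a -> 1 < b -> (a < m) && (b < m))%N.
  by case: a b => [|[|a]] [|[|b]] // le_m _ _; rewrite !addSn !addnS /= in le_m;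
    rewrite !(leq_trans _ le_m) // !ltnS ?leq_addr ?leq_addl.
have /andP[ltq ltr] := split_lt _ _ lepm sq sr.
have [u1 [s1 [u1U s1I ->]]] := IHm q ltq q0.
have [u2 [s2 [u2U s2I ->]]] := IHm r ltr r0.
exists (u1 * u2), (s1 ++ s2); rewrite unitrM u1U big_cat mulrACA; split=> // x.
by rewrite mem_cat => /orP[/s1I|/s2I].
Qed.

Lemma mpoly_irreducible_prime n (p : {mpoly C[n]}) :
  irreducible_elt p -> prime_elt p.
Proof.
elim: n p => [|n IHn] p pI.
  have [p0 pU _] := pI; have := mpoly_nonunit_msize p0 pU.
  by rewrite (nvar0_mpolyC p) msizeC; case: (_ != 0).
apply: uni0_prime; apply: irreducible_prime_poly; last exact: uni0_irreducible.
move=> c /mpoly_atomic[u [s [uU sI ->]]]; exists u, s; split=> // x /sI.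
exact: IHn.
Qed.

Lemma mpoly_factorial n : factorial {mpoly C[n]}.
Proof.
move=> c /mpoly_atomic[u [s [uU sI ->]]]; exists u, s; split=> // x /sI.
exact: mpoly_irreducible_prime.
Qed.

End MpolyFactorial.

Section UniqueFactorization.
Variables (C : numClosedFieldType) (N : nat).
Implicit Types (p q r : {mpoly C[N.+1]}) (s : seq {mpoly C[N.+1]}).

Definition normalized_irreducible r : Prop := mp_irreducible r /\ r.@[@e0 C N] = 1.

Lemma mpoly_unitC n (p : {mpoly C[n]}) :
  p \is a GRing.unit -> p = (p@_0)%:MP.
Proof. by case/andP => /eqP. Qed.

Lemma normalized_irreducible_dvd p q : normalized_irreducible p ->
  normalized_irreducible q -> elt_dvd p q -> p = q.
Proof.
move=> [[_ pU _] p1] [[_ _ qI] q1] [r qE].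
case: (qI _ _ qE) => [|/mpoly_unitC rE]; first by rewrite (negPf pU).
move: q1; rewrite qE mevalM p1 mul1r rE mevalC => ->.
by rewrite mpolyC1 mulr1.
Qed.

Lemma prime_dvd_prod (D : idomainType) (x : D) (s : seq D) :
  prime_elt x -> elt_dvd x (\prod_(y <- s) y) -> exists2 y, y \in s & elt_dvd x y.
Proof.
move=> [_ xU xP]; elim: s => [|y s IHs].
  by rewrite big_nil => -[z z1]; case/negP: xU; apply/unitrPr; exists z.
rewrite big_cons => /xP[xy|/IHs[z zs xz]]; first by exists y; rewrite ?mem_head.
by exists z => //; rewrite inE zs orbT.
Qed.

Lemma irreducible_factorization_unique s s' :
  (forall r, r \in s -> normalized_irreducible r) ->
  (forall r, r \in s' -> normalized_irreducible r) ->
  \prod_(r <- s) r = \prod_(r <- s') r -> perm_eq s s'.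
Proof.
elim: s s' => [|x s IHs] s' sI s'I.
  case: s' s'I => // y s' s'I; rewrite big_nil big_cons => E.
  have [[_ yU _] _] := s'I y (mem_head _ _).
  by case/negP: yU; apply/unitrPr; exists (\prod_(r <- s') r).
have xI := sI x (mem_head _ _); have [xI' _] := xI.
have xP : prime_elt x by apply: mpoly_irreducible_prime.
rewrite big_cons => E.
have [|y ys' /normalized_irreducible_dvd xy] := prime_dvd_prod (s := s') xP.
  by exists (\prod_(r <- s) r).
have {y ys' xy} xs' : x \in s' by rewrite (xy xI (s'I y ys')).
rewrite perm_sym (permPl (perm_to_rem xs')) perm_cons perm_sym.
apply: IHs => [r rs|r /mem_rem/s'I //|]; first by apply: sI; rewrite inE rs orbT.
have [x0 _ _] := xI'; apply: (mulfI x0).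
by rewrite E (perm_big _ (perm_to_rem xs')) big_cons.
Qed.

End UniqueFactorization.

Section SpectralIndices.
Variables (C : numClosedFieldType) (k : nat).
Implicit Types B : seq 'M[C]_k.

Definition radical B : {mpoly C[(size B).+1]} := \prod_(Rt <- factors B) Rt.1.

Definition spectral_defect B : nat := spectral_multiplicity B - spectral_index B.

Lemma factorsP B : irr_factorization (char_mpoly B) (factors B).
Proof. exact: (projT2 (cid (irr_factorization_exists B))). Qed.

Lemma spectral_of_factorization B (s : seq {mpoly C[(size B).+1]}) :
  (forall r, r \in s -> normalized_irreducible r) ->
  char_mpoly B = \prod_(r <- s) r ->
  [/\ spectral_multiplicity B = size s, spectral_index B = size (undup s) &
      radical B = \prod_(r <- undup s) r].
Proof.
move=> sI sE; have [fU fI fE] := factorsP B.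
pose fs := flatten [seq nseq Rt.2 Rt.1 | Rt <- factors B].
have fsE : \prod_(r <- fs) r = char_mpoly B.
  rewrite fE big_flatten big_map; apply: eq_bigr => Rt _.
  by rewrite big_nseq -Monoid.iteropE.
have fsI r : r \in fs -> normalized_irreducible r.
  move=> /flatten_mapP[Rt /fI[Rt1 Rt2 _]]; rewrite mem_nseq => /andP[_ /eqP->].
  by split.
have s_fs : perm_eq s fs.
  by apply: irreducible_factorization_unique; rewrite // -sE fsE.
have u_fs : perm_eq (undup s) [seq Rt.1 | Rt <- factors B].
  apply: uniq_perm; rewrite ?undup_uniq // => r; rewrite mem_undup (perm_mem s_fs).
  apply/flatten_mapP/mapP => [[Rt fRt]|[Rt fRt ->]].
    by rewrite mem_nseq => /andP[_ /eqP->]; exists Rt.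
  by exists Rt => //; rewrite mem_nseq eqxx andbT; case: (fI _ fRt).
split.
- rewrite (perm_size s_fs) size_flatten /shape -map_comp sumnE big_map.
  by apply: eq_bigr => Rt _; rewrite /= size_nseq.
- by rewrite (perm_size u_fs) size_map.
- by rewrite (perm_big _ u_fs) big_map.
Qed.

Lemma repeated_factors_defect B : repeated_factors B = (0 < spectral_defect B)%N.
Proof.
rewrite /repeated_factors /spectral_defect subn_gt0 /spectral_multiplicity.
rewrite /spectral_index -(sum1_size (factors B)); have [_ fI _] := factorsP B.
have : forall Rt, Rt \in factors B -> (0 < Rt.2)%N by move=> Rt /fI[].
elim: (factors B) => [|Rt f IHf] fp; first by rewrite !big_nil.
have Rtp := fp _ (mem_head _ _).
have fp' Rt' : Rt' \in f -> (0 < Rt'.2)%N by move=> h; apply: fp; rewrite inE h orbT.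
have le_f : (\sum_(i <- f) 1 <= \sum_(i <- f) i.2)%N.
  by rewrite big_seq [leqRHS]big_seq; apply: leq_sum => i /fp'.
rewrite !big_cons /= (IHf fp').
case: Rt.2 Rtp => // -[|t] _; first by rewrite ltn_add2l.
by rewrite /= add1n !addSn !ltnS (leq_trans le_f) ?leq_addl.
Qed.

End SpectralIndices.

Section Homogeneity.
Variables (C : numClosedFieldType).

Definition homogeneous n (m : nat) (p : {mpoly C[n]}) : Prop :=
  forall t v, p.@[fun i => t * v i] = t ^+ m * p.@[v].

(* p(t z) as a polynomial in t. *)
Definition dilate n : {mpoly C[n]} -> {poly {mpoly C[n]}} :=
  mmap (polyC \o @mpolyC n C) (fun i => ('X_i : {mpoly C[n]}) *: 'X).

HB.instance Definition _ n := GRing.RMorphism.on (@dilate n).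

Lemma dilateC n c : dilate (c%:MP : {mpoly C[n]}) = c%:MP%:P.
Proof. by rewrite /dilate mmapC. Qed.

Lemma dilateX n i : dilate ('X_i : {mpoly C[n]}) = 'X_i *: 'X.
Proof. by rewrite /dilate mmapXU. Qed.

Lemma dilate_horner n (p : {mpoly C[n]}) t v :
  (dilate p).[t%:MP].@[v] = p.@[fun i => t * v i].
Proof.
apply: (mpoly_rmorph_ext (f := meval v \o horner_eval t%:MP \o @dilate n)
  (g := meval (fun i => t * v i))) => [c|i] /=.
  by rewrite dilateC /horner_eval hornerC !mevalC.
by rewrite dilateX /horner_eval hornerZ hornerX mevalM mevalC !mevalXU mulrC.
Qed.

Lemma dilate1 n (p : {mpoly C[n]}) : (dilate p).[1] = p.
Proof.
apply: (mpoly_rmorph_ext (f := horner_eval 1 \o @dilate n) (g := idfun)) => [c|i] /=.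
  by rewrite dilateC /horner_eval hornerC.
by rewrite dilateX /horner_eval hornerZ hornerX mulr1.
Qed.

Lemma dilate0 n (p : {mpoly C[n]}) : (dilate p).[0] = (p.@[fun=> 0])%:MP.
Proof.
apply: (mpoly_rmorph_ext (f := horner_eval 0 \o @dilate n)
  (g := @mpolyC n C \o meval (fun=> 0))) => [c|i] /=.
  by rewrite dilateC /horner_eval hornerC mevalC.
by rewrite dilateX /horner_eval hornerZ hornerX mulr0 mevalXU mpolyC0.
Qed.

Lemma divisor_of_monomial (D : idomainType) (p q : {poly D}) c k :
  c != 0 -> p * q = c *: 'X^k -> exists a m, p = a *: 'X^m.
Proof.
move=> c0; elim: k p q => [|k IHk] p q E.
  rewrite expr0 in E; have [p0 q0] : p != 0 /\ q != 0.
    by apply/andP; rewrite -negb_or -mulf_eq0 E scale_poly_eq0 oner_eq0 orbF.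
  have : size (p * q) = 1%N by rewrite E size_scale // size_poly1.
  move/eqP; rewrite size_mul // => sp; exists p`_0, 0%N.
  rewrite expr0 alg_polyC; apply: size1_polyC.
  move: p0 q0 sp; rewrite -!size_poly_gt0; case: (size p) (size q) => [|a] [|b] // _ _.
  by rewrite addSn addnS /= eqSS addn_eq0 => /andP[/eqP->].
have X0 : 'X != 0 :> {poly D} by rewrite polyX_eq0.
have : root (p * q) 0 by rewrite E rootE hornerZ hornerXn expr0n mulr0.
rewrite rootM => /orP[]/factor_theorem[r rE]; rewrite subr0 in rE.
  have [|a [m rE']] := IHk r q; last by exists a, m.+1; rewrite rE rE' exprSr scalerAl.
  by apply: (mulIf X0); rewrite mulrAC -rE E exprSr scalerAl.
by apply: (IHk p r); apply: (mulIf X0); rewrite -mulrA -rE E exprSr scalerAl.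
Qed.

Variable k : nat.
Implicit Types B : seq 'M[C]_k.

Lemma dilate_char_mpoly B : dilate (char_mpoly B) = char_mpoly B *: 'X^k.
Proof.
rewrite -det_map_mx; set M := (X in map_mx _ X).
suff -> : map_mx (@dilate _) M = 'X *: map_mx polyC M.
  by rewrite detZ det_map_mx mulrC mul_polyC.
have dilate_term a (T : 'M[C]_k) :
    map_mx (@dilate _) ('X_a *: map_mx (@mpolyC (size B).+1 C) T) =
    'X *: map_mx polyC ('X_a *: map_mx (@mpolyC (size B).+1 C) T).
  apply/matrixP => i j; rewrite !mxE rmorphM /= dilateX dilateC polyCM.
  by rewrite -mul_polyC mulrCA !mulrA.
rewrite /M -(map_mx1 (@mpolyC (size B).+1 C)) !map_mxD !raddf_sum scalerDr scaler_sumr /=.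
by congr (_ + _); last apply: eq_bigr => i _; rewrite dilate_term.
Qed.

Lemma divisor_homogeneous B p q : char_mpoly B = p * q ->
  exists m, homogeneous m p /\ (mp_irreducible p -> (0 < m)%N).
Proof.
move=> E; have Q0 : char_mpoly B != 0.
  by apply: contra_eq_neq (char_mpoly_e0 B) => ->; rewrite meval0 eq_sym oner_eq0.
have [a [m pE]] : exists a m, dilate p = a *: 'X^m.
  by apply: (divisor_of_monomial (q := dilate q) Q0); rewrite -rmorphM -E /= dilate_char_mpoly.
have aE : a = p by rewrite -[RHS]dilate1 pE hornerZ hornerXn expr1n mulr1.
rewrite aE in pE; exists m; split=> [t v|[p0 pU _]].
  by rewrite -dilate_horner pE hornerZ hornerXn mevalM mulrC rmorphXn /= mevalC.
rewrite lt0n; apply: contraNneq pU => m0.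
have := dilate0 p; rewrite pE m0 expr0 hornerZ hornerC mulr1; set c := meval _ _ => pC.
have c0 : c != 0 by rewrite -(mpolyC_eq0 (size B).+1) -pC.
by apply/unitrPr; exists c^-1%:MP; rewrite pC -mpolyCM divff.
Qed.

Lemma factor_homogeneous B Rt : Rt \in factors B ->
  exists2 m, homogeneous m Rt.1 & (0 < m)%N.
Proof.
have [_ fI fE] := factorsP B => fRt; have [RI _ R2] := fI _ fRt.
have [|m [Rh /(_ RI) m0]] := @divisor_homogeneous B Rt.1
  (Rt.1 ^+ Rt.2.-1 * \prod_(Rt' <- rem Rt (factors B)) Rt'.1 ^+ Rt'.2).
  by rewrite fE (big_rem _ fRt) /= mulrA -exprS prednK.
by exists m.
Qed.

End Homogeneity.

Section LinearSubstitution.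
Variables (C : numClosedFieldType) (M N : nat).
Variables (E : 'I_M -> 'I_N -> C) (c : 'I_M -> C).

Definition subst_tuple : (N.+1).-tuple {mpoly C[M.+1]} :=
  [tuple oapp (fun s => \sum_(i < M) E i s *: 'X_(lift ord0 i))
              ('X_ord0 + \sum_(i < M) c i *: 'X_(lift ord0 i))
              (unlift ord0 j) | j < N.+1].

Definition lin_subst : {mpoly C[N.+1]} -> {mpoly C[M.+1]} := comp_mpoly subst_tuple.

HB.instance Definition _ := GRing.RMorphism.on lin_subst.

Lemma lin_substC a : lin_subst a%:MP = a%:MP.
Proof. exact: comp_mpolyC. Qed.

Lemma lin_substX0 :
  lin_subst 'X_ord0 = 'X_ord0 + \sum_(i < M) c i *: 'X_(lift ord0 i).
Proof. by rewrite /lin_subst comp_mpolyXU -tnth_nth tnth_mktuple unlift_none. Qed.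

Lemma lin_substXS s :
  lin_subst 'X_(lift ord0 s) = \sum_(i < M) E i s *: 'X_(lift ord0 i).
Proof. by rewrite /lin_subst comp_mpolyXU -tnth_nth tnth_mktuple liftK. Qed.

Lemma meval_lin_subst p (v : 'I_M.+1 -> C) :
  (lin_subst p).@[v] =
  p.@[fun j => oapp (fun s => \sum_(i < M) E i s * v (lift ord0 i))
                    (v ord0 + \sum_(i < M) c i * v (lift ord0 i)) (unlift ord0 j)].
Proof.
rewrite comp_mpoly_meval; apply: meval_eq => j; rewrite tnth_mktuple.
case: (unlift ord0 j) => [s|] /=; rewrite ?mevalD ?mevalXU raddf_sum /=; last congr (_ + _).
  by apply: eq_bigr => i _; rewrite mevalZ mevalXU.
by apply: eq_bigr => i _; rewrite mevalZ mevalXU.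
Qed.

Lemma lin_subst_axis0 p t :
  (lin_subst p).@[fun i => t * @e0 C M i] = p.@[fun i => t * @e0 C N i].
Proof.
rewrite meval_lin_subst; apply: meval_eq => j; rewrite /e0.
case: (unliftP ord0 j) => [s|] -> /=.
  by rewrite !mulr0 big1 // => i _; rewrite !mulr0.
by rewrite big1 ?addr0 // => i _; rewrite !mulr0.
Qed.

Lemma lin_subst_e0 p : (lin_subst p).@[@e0 C M] = p.@[@e0 C N].
Proof.
have := lin_subst_axis0 p 1; congr (_ = _);
by apply: meval_eq => i; rewrite mul1r.
Qed.

End LinearSubstitution.

Section Comparison.
Variables (C : numClosedFieldType) (k : nat) (B Bt : seq 'M[C]_k).
Variables (E : 'I_(size B) -> 'I_(size Bt) -> C) (c : 'I_(size B) -> C).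
Variable S : 'M[C]_k.
Hypothesis S_unit : S \in unitmx.
Hypothesis BE : forall i : 'I_(size B),
  B`_i = invmx S *m (\sum_(s < size Bt) E i s *: Bt`_s) *m S + (c i)%:M.

Lemma lin_subst_char_mpoly : lin_subst E c (char_mpoly Bt) = char_mpoly B.
Proof.
rewrite -det_map_mx; set T := map_mx _ _.
pose mp (T' : 'M[C]_k) := map_mx (@mpolyC (size B).+1 C) T'.
have SK : mp (invmx S) *m mp S = 1%:M by rewrite /mp -map_mxM mulVmx // map_mx1.
suff -> : char_mpoly B = \det (mp (invmx S) *m T *m mp S).
  by rewrite !det_mulmx mulrAC -det_mulmx SK det1 mul1r.
have TE : T = lin_subst E c 'X_ord0 *: 1%:M +
    \sum_(s < size Bt) lin_subst E c 'X_(lift ord0 s) *: mp Bt`_s.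
  rewrite /T map_mxD raddf_sum /= map_mxZ map_mx1; congr (_ + _).
  apply: eq_bigr => s _; rewrite map_mxZ; congr (_ *: _).
  by apply/matrixP => a b; rewrite !mxE /= lin_substC.
have {}TE : T = 'X_ord0 *: 1%:M + \sum_(i < size B) 'X_(lift ord0 i) *:
    mp (\sum_(s < size Bt) E i s *: Bt`_s + (c i)%:M).
  rewrite TE lin_substX0 scalerDl -addrA; congr (_ + _).
  rewrite scaler_suml (eq_bigr (fun s : 'I_(size Bt) => \sum_(i < size B)
     'X_(lift ord0 i) *: mp (E i s *: Bt`_s))); last first.
    move=> s _; rewrite lin_substXS scaler_suml; apply: eq_bigr => i _.
    by rewrite /mp map_mxZ /= scalerA -mul_mpolyC mulrC.
  rewrite exchange_big -big_split; apply: eq_bigr => i _ /=.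
  rewrite /mp map_mxD raddf_sum scalerDr scaler_sumr addrC; congr (_ + _).
  by rewrite map_scalar_mx /= -[in RHS]scalemx1 scalerA -mul_mpolyC mulrC.
rewrite /char_mpoly TE mulmxDr mulmxDl; congr (\det (_ + _)).
  by rewrite -scalemxAr mulmx1 -scalemxAl SK.
rewrite mulmx_sumr mulmx_suml; apply: eq_bigr => i _.
rewrite -scalemxAr -scalemxAl BE; congr (_ *: _).
rewrite /mp -!map_mxM mulmxDr mulmxDl; congr (map_mx _ (_ + _)).
by rewrite scalar_mxC -mulmxA mulVmx // mulmx1.
Qed.

(* With Q_Bt = prod_j R_j^(t_j), the substituted R_j is a product of a nonempty
   list rs_j of irreducible factors of Q_B.  Hence nu(B) = sum_j t_j |rs_j|, and
   kappa(B) is the number of distinct members of the concatenation of the rs_j,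
   at most sum_j |rs_j|; equality of the defects forces these members to be
   pairwise distinct. *)
Lemma spectral_defect_compare :
  (spectral_defect Bt <= spectral_defect B)%N /\
  (spectral_defect Bt = spectral_defect B ->
   radical B = lin_subst E c (radical Bt)).
Proof.
have /boolp.choice[rs rsP] : forall R : {mpoly C[(size Bt).+1]},
    exists s : seq {mpoly C[(size B).+1]}, R.@[@e0 C _] = 1 ->
      (forall r, r \in s -> normalized_irreducible r) /\
      lin_subst E c R = \prod_(r <- s) r.
  move=> R; have [R1|R1] := pselect (R.@[@e0 C _] = 1); last by exists [::].
  have [s sI sE] : exists2 s, forall r, r \in s -> mp_irreducible r /\ r.@[@e0 C _] = 1 &
      lin_subst E c R = \prod_(r <- s) r.
    by apply: irr_prod_exists; rewrite lin_subst_e0.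
  by exists s.
have [_ fI fE] := factorsP Bt; set ft := factors Bt in fI fE.
have rs_gt0 Rt : Rt \in ft -> (0 < size (rs Rt.1))%N.
  move=> ftR; have [_ R1 _] := fI _ ftR.
  have [_ rsE] := rsP _ R1; rewrite lt0n size_eq0; apply/eqP => rs0.
  have [m Rh m0] := factor_homogeneous ftR.
  have := lin_subst_axis0 E c Rt.1 2; rewrite rsE rs0 big_nil meval1 Rh R1 mulr1.
  move/eqP; rewrite eq_sym -[1]/(1%:R) -natrX eqr_nat => /eqP m2.
  by have := ltn_expl m (isT : (1 < 2)%N); rewrite m2 ltnS leqNgt m0.
pose u := flatten [seq rs Rt.1 | Rt <- ft].
pose s := flatten [seq flatten (nseq Rt.2 (rs Rt.1)) | Rt <- ft].
have sE : char_mpoly B = \prod_(r <- s) r.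
  rewrite -lin_subst_char_mpoly fE rmorph_prod big_flatten big_map big_seq [RHS]big_seq.
  apply: eq_bigr => Rt /fI[_ R1 _]; rewrite rmorphXn big_flatten big_nseq.
  by rewrite -Monoid.iteropE; have [_ <-] := rsP _ R1.
have uE : lin_subst E c (radical Bt) = \prod_(r <- u) r.
  rewrite rmorph_prod big_flatten big_map big_seq [RHS]big_seq.
  by apply: eq_bigr => Rt /fI[_ R1 _]; have [_ <-] := rsP _ R1.
have s_u : s =i u.
  move=> r; apply/flatten_mapP/flatten_mapP => -[Rt ftR].
    by move=> /flattenP[x]; rewrite mem_nseq => /andP[_ /eqP->]; exists Rt.
  move=> rR; exists Rt => //; apply/flattenP; exists (rs Rt.1) => //.
  by rewrite mem_nseq eqxx andbT; case: (fI _ ftR).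
have sI r : r \in s -> normalized_irreducible r.
  by rewrite s_u => /flatten_mapP[Rt /fI[_ R1 _]]; have [rI _] := rsP _ R1; apply: rI.
have [nuB kaB radB] := spectral_of_factorization sI sE.
have size_s : (size s = \sum_(Rt <- ft) Rt.2.-1 * size (rs Rt.1) + size u)%N.
  rewrite !size_flatten /shape -!map_comp !sumnE !big_map -big_split big_seq [RHS]big_seq.
  apply: eq_bigr => Rt /fI[_ _ R2] /=.
  rewrite size_flatten /shape map_nseq sumn_nseq mulnC.
  by rewrite -{1}(prednK R2) mulSn addnC.
have defBt : spectral_defect Bt = (\sum_(Rt <- ft) Rt.2.-1)%N.
  rewrite /spectral_defect /spectral_multiplicity /spectral_index -(sum1_size (factors Bt)).
  rewrite -/ft -[X in (X - _)%N](_ : \sum_(Rt <- ft) (Rt.2.-1 + 1) = _)%N.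
    by rewrite big_split addnK.
  by rewrite big_seq [RHS]big_seq; apply: eq_bigr => Rt /fI[_ _ R2]; rewrite addn1 prednK.
have le_ft : (\sum_(Rt <- ft) Rt.2.-1 <= \sum_(Rt <- ft) Rt.2.-1 * size (rs Rt.1))%N.
  rewrite big_seq [leqRHS]big_seq; apply: leq_sum => Rt /rs_gt0.
  exact: leq_pmulr.
have undup_su : size (undup s) = size (undup u).
  by apply/eqP; rewrite -uniq_size_uniq ?undup_uniq // => r; rewrite !mem_undup s_u.
have le_u := size_undup u.
have defB : spectral_defect B =
    (\sum_(Rt <- ft) Rt.2.-1 * size (rs Rt.1) + (size u - size (undup u)))%N.
  by rewrite /spectral_defect nuB kaB size_s undup_su addnBA.
rewrite defBt defB; split; first by rewrite (leq_trans le_ft) ?leq_addr.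
move=> /esym/eqP defE; have u_uniq : uniq u.
  rewrite -[uniq u]negbK -ltn_size_undup -leqNgt -subn_eq0 -leqn0.
  by rewrite -(leq_add2l (\sum_(Rt <- ft) Rt.2.-1 * size (rs Rt.1))) addn0 (eqP defE).
rewrite radB uE; apply: perm_big; apply: uniq_perm; rewrite ?undup_uniq // => r.
by rewrite mem_undup s_u.
Qed.

End Comparison.

Section ChainRule.
Variables (C : numClosedFieldType) (n : nat).

Lemma mpoly_gen_ind (P : {mpoly C[n]} -> Prop) :
  (forall c, P c%:MP) -> (forall i, P 'X_i) ->
  (forall p q, P p -> P q -> P (p + q)) -> (forall p q, P p -> P q -> P (p * q)) ->
  forall p, P p.
Proof.
move=> PC PX PD PM p; rewrite [p]mpolyE; apply: big_ind => // [|m _].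
  exact: PC 0.
rewrite -mul_mpolyC mpolyXE_id; apply: (PM) => //.
apply: big_ind => // [|i _]; first exact: PC 1.
by elim: (m i) => [|e IHe]; [exact: PC 1 | rewrite exprS; exact: PM].
Qed.

Lemma mderivXU i j : ('X_j : {mpoly C[n]})^`M(i) = (i == j)%:R.
Proof.
rewrite mderivX mnm1E eq_sym; case: eqP => [->|_]; last by rewrite scale0r.
have -> : (U_(j) - U_(j) = 0)%MM by apply/mnmP => a; rewrite mnmBE mnm0E subnn.
by rewrite mpolyX0 scale1r.
Qed.

Lemma deriv_mmap (h : 'I_n -> {poly C}) (p : {mpoly C[n]}) :
  (mmap polyC h p)^`() = \sum_i mmap polyC h p^`M(i) * (h i)^`().
Proof.
elim/mpoly_gen_ind: p => [c|j|p q IHp IHq|p q IHp IHq].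
- rewrite mmapC derivC big1 // => i _.
  by rewrite mderivC rmorph0 mul0r.
- rewrite mmapXU (bigD1 j) //= mderivXU eqxx rmorph1 mul1r big1 ?addr0 // => i ij.
  by rewrite mderivXU (negPf ij) rmorph0 mul0r.
- rewrite rmorphD derivD IHp IHq -big_split; apply: eq_bigr => i _.
  by rewrite mderivD rmorphD mulrDl.
- rewrite rmorphM derivM IHp IHq mulr_suml mulr_sumr -big_split.
  apply: eq_bigr => i _ /=; rewrite mderivM rmorphD !rmorphM mulrDl.
  by congr (_ + _); [rewrite mulrAC | rewrite mulrA].
Qed.

End ChainRule.

Section Line.
Variables (C : numClosedFieldType) (N : nat).
Implicit Types (d v : 'I_N -> C) (p : {mpoly C[N.+1]}).

Definition affine_point d (j : 'I_N.+1) : C := oapp d (-1) (unlift ord0 j).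

Definition axis (i : 'I_N) : 'I_N -> C := fun j => (j == i)%:R.

(* The univariate polynomial p(-1, t d) in t. *)
Definition line_poly d : {mpoly C[N.+1]} -> {poly C} :=
  mmap polyC (fun j => oapp (fun s => d s *: 'X) (-1) (unlift ord0 j)).

HB.instance Definition _ d := GRing.RMorphism.on (line_poly d).

Lemma line_polyC d c : line_poly d c%:MP = c%:P.
Proof. exact: mmapC. Qed.

Lemma line_polyX d j :
  line_poly d 'X_j = oapp (fun s => d s *: 'X) (-1) (unlift ord0 j).
Proof. exact: mmapXU. Qed.

Lemma dehom_meval p v : (dehom p).@[v] = p.@[affine_point v].
Proof.
rewrite comp_mpoly_meval; apply: meval_eq => j; rewrite tnth_mktuple /affine_point.
by case: (unlift ord0 j) => [s|] /=; rewrite ?mevalXU // mevalN meval1.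
Qed.

Lemma line_poly_dehom d p :
  line_poly d p = mmap polyC (fun s => d s *: 'X) (dehom p).
Proof.
apply: (mpoly_rmorph_ext (f := line_poly d)
  (g := mmap polyC (fun s => d s *: 'X) \o @dehom C N)) => [c|j] /=.
  by rewrite line_polyC /dehom comp_mpolyC mmapC.
rewrite line_polyX /dehom comp_mpolyXU -tnth_nth tnth_mktuple.
by case: (unlift ord0 j) => [s|] /=; rewrite ?mmapXU // rmorphN rmorph1.
Qed.

Lemma horner_mmap n (h : 'I_n -> {poly C}) (p : {mpoly C[n]}) t :
  (mmap polyC h p).[t] = p.@[fun i => (h i).[t]].
Proof.
apply: (mpoly_rmorph_ext (f := horner_eval t \o mmap polyC h)
  (g := meval (fun i => (h i).[t]))) => [c|i] /=.
  by rewrite mmapC /horner_eval hornerC mevalC.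
by rewrite mmapXU /horner_eval mevalXU.
Qed.

Lemma line_poly_horner d p t :
  (line_poly d p).[t] = p.@[affine_point (fun s => t * d s)].
Proof.
rewrite line_poly_dehom horner_mmap -dehom_meval; apply: meval_eq => s.
by rewrite hornerZ hornerX mulrC.
Qed.

Lemma line_poly_deriv d p t : (line_poly d p)^`().[t] =
  \sum_s (dehom p)^`M(s).@[fun s' => t * d s'] * d s.
Proof.
rewrite line_poly_dehom deriv_mmap horner_sum; apply: eq_bigr => s _.
rewrite hornerM horner_mmap derivZ derivX hornerZ hornerC mulr1; congr (_ * _).
by apply: meval_eq => s'; rewrite hornerZ hornerX mulrC.
Qed.

Lemma line_poly_deriv_axis i p t :
  (line_poly (axis i) p)^`().[t] = (dehom p)^`M(i).@[fun s => t * axis i s].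
Proof.
rewrite line_poly_deriv (bigD1 i) //= {2}/axis eqxx mulr1 big1 ?addr0 // => s si.
by rewrite {2}/axis (negPf si) mulr0.
Qed.

End Line.

Section AdmissibilityCriterion.
Variables (C : numClosedFieldType) (k : nat).
Implicit Types B : seq 'M[C]_k.

Definition simple_along B (d : 'I_(size B) -> C) : Prop :=
  forall t, root (line_poly d (radical B)) t ->
            (line_poly d (radical B))^`().[t] != 0.

Lemma reduced_polyE B : reduced_poly B = dehom (radical B).
Proof. by rewrite /radical /dehom rmorph_prod. Qed.

Lemma char_mpoly_meval B v : (char_mpoly B).@[v] =
  \det (v ord0 *: 1%:M + \sum_(i < size B) v (lift ord0 i) *: B`_i).
Proof.
rewrite -det_map_mx; congr (\det _); apply/matrixP => a b.
rewrite !mxE /= !summxE mevalD mevalM mevalXU raddf_sum /=; congr (_ * _ + _).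
  by case: (a == b); rewrite ?meval1 ?meval0.
by apply: eq_bigr => i _; rewrite !mxE mevalM mevalXU mevalC.
Qed.

Lemma char_mpoly_root B v : ((char_mpoly B).@[v] == 0) = ((radical B).@[v] == 0).
Proof.
have [_ fI ->] := factorsP B; rewrite /radical !rmorph_prod !prodf_seq_eq0 /=.
apply: eq_in_has => Rt /fI[_ _ R2].
by rewrite rmorphXn expf_eq0 R2.
Qed.

Lemma in_spectrum_root B (z : 'I_(size B) -> C) :
  in_spectrum z <-> (radical B).@[affine_point z] = 0.
Proof.
rewrite /in_spectrum; have := @char_mpoly_root B (affine_point z).
rewrite char_mpoly_meval /affine_point unlift_none /=.
rewrite (eq_bigr (fun i : 'I_(size B) => z i *: B`_i)); last by move=> i _; rewrite liftK.
have -> : -1 *: 1%:M + \sum_(i < size B) z i *: B`_i =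
    -1 *: (1%:M - \sum_(i < size B) z i *: B`_i) :> 'M[C]_k.
  by rewrite !scaleN1r opprB addrC.
rewrite detZ mulf_eq0 expf_eq0 oppr_eq0 oner_eq0 andbF /= => E.
by split=> /eqP; [rewrite E|rewrite -E] => /eqP.
Qed.

Lemma admissibleP B : admissible B <-> forall i, simple_along (@axis C (size B) i).
Proof.
split=> [adm i t rt|simp i z zS z_axis].
  rewrite line_poly_deriv_axis -reduced_polyE; apply: adm.
    by apply/in_spectrum_root; rewrite -line_poly_horner; apply/rootP.
  by move=> j ji; rewrite /axis (negPf ji) mulr0.
have zE : z =1 (fun s => z i * axis C i s).
  move=> s; rewrite /axis; case: (eqVneq s i) => [->|/z_axis->]; first by rewrite mulr1.
  by rewrite mulr0.
rewrite reduced_polyE (meval_eq _ zE) -line_poly_deriv_axis; apply: simp.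
apply/rootP; rewrite line_poly_horner.
move/in_spectrum_root: zS => <-; apply: meval_eq => j.
by rewrite /affine_point; case: (unlift ord0 j) => //= s; rewrite -zE.
Qed.

Lemma line_poly_lin_subst M N (E : 'I_M -> 'I_N -> C) d p :
  line_poly d (lin_subst E (fun=> 0) p) =
  line_poly (fun s => \sum_i E i s * d i) p.
Proof.
apply: (mpoly_rmorph_ext (f := line_poly d \o lin_subst E (fun=> 0))
  (g := line_poly (fun s => \sum_i E i s * d i))) => [c|j] /=.
  by rewrite lin_substC !line_polyC.
case: (unliftP ord0 j) => [s|] ->.
  rewrite lin_substXS rmorph_sum /= line_polyX liftK /= scaler_suml.
  apply: eq_bigr => i _.
  by rewrite -mul_mpolyC rmorphM /= line_polyC line_polyX liftK /= mul_polyC scalerA.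
rewrite lin_substX0 big1 ?addr0 => [|i _]; last by rewrite scale0r.
by rewrite !line_polyX !unlift_none.
Qed.

Lemma simple_along_compare B Bt (E : 'I_(size B) -> 'I_(size Bt) -> C) S d d' :
  S \in unitmx ->
  (forall i : 'I_(size B), B`_i = invmx S *m (\sum_(s < size Bt) E i s *: Bt`_s) *m S) ->
  spectral_defect Bt = spectral_defect B ->
  (forall s, \sum_i E i s * d i = d' s) ->
  simple_along (B := Bt) d' <-> simple_along (B := B) d.
Proof.
move=> SU BE defE dE; have BE0 (i : 'I_(size B)) :
    B`_i = invmx S *m (\sum_(s < size Bt) E i s *: Bt`_s) *m S + 0%:M.
  by rewrite raddf0 addr0.
have [_ /(_ defE) radE] := spectral_defect_compare (c := fun=> 0) SU BE0.
rewrite /simple_along radE line_poly_lin_subst.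
by have /funext -> : (fun s => \sum_i E i s * d i) =1 d' by [].
Qed.


Lemma spectrally_stable_of_defect B X : admissible B ->
  spectral_defect (B ++ X) = spectral_defect B -> spectrally_stable B (B ++ X).
Proof.
set Bt := B ++ X => /admissibleP adm defE i lambda iB eig lambda0 tau.
pose i' := Ordinal iB.
pose E (a : 'I_(size B)) (s : 'I_(size Bt)) : C := (a == s :> nat)%:R.
have simp : simple_along (@axis C (size Bt) i).
  apply/(simple_along_compare (B := B) (E := E) (S := 1%:M) (d := axis C i')); last 1 first.
  - exact: adm.
  - exact: unitmx1.
  - move=> a; rewrite invmx1 mul1mx mulmx1.
    have aBt : (a < size Bt)%N by rewrite size_cat ltn_addr.
    rewrite (bigD1 (Ordinal aBt)) //= /E eqxx scale1r big1 ?addr0.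
      by rewrite nth_cat ltn_ord.
    by move=> s; rewrite -val_eqE /= eq_sym => /negPf->; rewrite scale0r.
  - exact: defE.
  - move=> s; rewrite (bigD1 i') //= /axis eqxx mulr1 big1 ?addr0.
      by rewrite /E /= eq_sym.
    by move=> a /negPf->; rewrite mulr0.
have tauE : tau =1 (fun s => lambda^-1 * axis C i s).
  by move=> s; rewrite /tau /axis; case: (s == i); rewrite ?mulr1 ?mulr0.
pose L R := line_poly (axis C i) R.
have rootE R : (dehom R).@[tau] = (L R).[lambda^-1].
  by rewrite (meval_eq _ tauE) dehom_meval line_poly_horner.
have derE R : (mderiv i (dehom R)).@[tau] = (L R)^`().[lambda^-1].
  by rewrite (meval_eq _ tauE) line_poly_deriv_axis.
pose rs := [seq Rt.1 | Rt <- factors Bt].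
have radE : radical Bt = \prod_(R <- rs) R by rewrite big_map.
have rad0 : root (L (radical Bt)) lambda^-1.
  apply/rootP; rewrite -rootE dehom_meval; apply/in_spectrum_root.
  apply/eqP/det0P; have /eigenvalueP[v vB v0] := eig; exists v => //.
  rewrite mulmxBr mulmx1 (bigD1 i) //= /tau eqxx big1 ?addr0; last first.
    by move=> s /negPf->; rewrite scale0r.
  by rewrite nth_cat iB -scalemxAr vB scalerA mulVf // scale1r subrr.
have rad1 := simp _ rad0.
have [R rsR R0] : exists2 R, R \in rs & (L R).[lambda^-1] = 0.
  move: rad0; rewrite radE /L rmorph_prod /= => /rootP/eqP.
  rewrite horner_prod prodf_seq_eq0 => /hasP[R rsR /eqP R0].
  by exists R.
have rsU : uniq rs by case: (factorsP Bt).
move: rad1; rewrite -/(L _) radE (big_rem _ rsR) /= /L rmorphM derivM hornerD !hornerM.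
rewrite -/(L R) R0 mul0r addr0 mulf_eq0 negb_or => /andP[R1 rest0].
exists R; split=> //; rewrite ?rootE ?derE // => R' rsR'.
rewrite rootE => R'0; apply/eqP; apply: contraNT rest0 => R'R.
rewrite rmorph_prod horner_prod prodf_seq_eq0 /=; apply/hasP; exists R'.
  by rewrite mem_rem_uniq // !inE R'R.
by rewrite -/(L R') R'0.
Qed.

End AdmissibilityCriterion.

Section Nonvanishing.
Variable C : numClosedFieldType.

Lemma poly_nonroot (p : {poly C}) (f : nat -> C) :
  injective f -> p != 0 -> exists i, p.[f i] != 0.
Proof.
move=> f_inj p0; apply: contrapT => /forallNP pf.
have /(max_poly_roots p0) : all (root p) [seq f i | i <- iota 0 (size p)].
  by apply/allP => _ /mapP[i _ ->]; apply/rootP/eqP; have /negP := pf i; rewrite negbK.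
by rewrite map_inj_uniq // iota_uniq size_map size_iota ltnn => /(_ isT).
Qed.

Lemma natr_inj : injective (fun i : nat => i%:R : C).
Proof. by move=> i j /eqP; rewrite eqr_nat => /eqP. Qed.

Lemma poly_funext (p q : {poly C}) : (forall t, p.[t] = q.[t]) -> p = q.
Proof.
move=> pq; apply/eqP; rewrite -subr_eq0; apply/negPn/negP.
move=> /(poly_nonroot natr_inj)[j].
by rewrite hornerD hornerN pq subrr eqxx.
Qed.

Lemma uni0_meval n (p : {mpoly C[n.+1]}) v :
  (map_poly (meval (fun j => v (lift ord0 j))) (uni0 p)).[v ord0] = p.@[v].
Proof.
apply: (mpoly_rmorph_ext (f := horner_eval (v ord0) \o
  map_poly (meval (fun j => v (lift ord0 j))) \o @uni0 n C) (g := meval v)) => [c|i] /=.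
  by rewrite uni0C map_polyC /horner_eval hornerC /= !mevalC.
case: (unliftP ord0 i) => [j|] ->; rewrite mevalXU /horner_eval.
  by rewrite uni0XS map_polyC hornerC /= mevalXU.
by rewrite uni0X0 map_polyX hornerX.
Qed.

Lemma mpoly_nonroot n (p : {mpoly C[n]}) :
  p != 0 -> exists w : 'I_n -> nat, p.@[fun i => (w i)%:R] != 0.
Proof.
elim: n p => [|n IHn] p p0.
  by exists (fun=> 0%N); move: p0; rewrite (nvar0_mpolyC p) mevalC mpolyC_eq0.
have : lead_coef (uni0 p) != 0.
  by rewrite lead_coef_eq0; apply: contraNneq p0 => p0; rewrite -[p]uni0K p0 rmorph0.
move=> /IHn[w w0].
have : map_poly (meval (fun i => (w i)%:R)) (uni0 p) != 0.
  apply: contraNneq w0 => /(congr1 (fun q : {poly C} => q`_(size (uni0 p)).-1)).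
  by rewrite coef_map coef0 => ->.
move=> /(poly_nonroot natr_inj)[a a0].
pose v (j : 'I_n.+1) := oapp w a (unlift ord0 j).
exists v; rewrite -uni0_meval /v unlift_none /=.
set p' := (X in X.[_]); suff -> : p' = map_poly (meval (fun i => (w i)%:R)) (uni0 p) by [].
apply/polyP => i; rewrite !coef_map /=; apply: meval_eq => j.
by rewrite liftK.
Qed.

End Nonvanishing.

Section SimpleDirections.
Variables (C : numClosedFieldType).

Lemma irreducible_deriv_neq0 n (R : {mpoly C[n.+1]}) m : (0 < m)%N ->
  homogeneous m R -> R.@[@e0 C n] = 1 -> (uni0 R)^`() != 0.
Proof.
move=> m0 Rh R1; apply/eqP => R'0.
pose g := map_poly (meval (fun j : 'I_n => 0 : C)) (uni0 R).
have gE t : g.[t] = t ^+ m.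
  rewrite -[RHS]mulr1 -R1 -Rh -uni0_meval /e0 eqxx mulr1 /g.
  congr (map_poly _ _).[_]; apply: funext => p; apply: meval_eq => j.
  by rewrite mulr0.
have gX : g = 'X^m by apply: poly_funext => t; rewrite gE hornerXn.
have /(congr1 (horner^~ 1)) : g^`() = 0 by rewrite deriv_map R'0 rmorph0.
rewrite gX derivXn hornerMn hornerXn expr1n horner0 => /eqP.
by rewrite pnatr_eq0 -leqn0 leqNgt m0.
Qed.

Lemma coprimep_prod_deriv n (s : seq {mpoly C[n.+1]}) : uniq s ->
  (forall R, R \in s -> normalized_irreducible R /\ (uni0 R)^`() != 0) ->
  coprimep (\prod_(R <- s) uni0 R) (\prod_(R <- s) uni0 R)^`().
Proof.
have cop R (f : {poly {mpoly C[n]}}) : normalized_irreducible R -> (uni0 R)^`() != 0 ->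
    coprimep (uni0 R) f \/ elt_dvd (uni0 R) f.
  move=> [RI _] R'0; apply: irreducible_coprime_or_dvd.
  - exact: mpoly_factorial.
  - exact: uni0_irreducible.
  - have R0 : uni0 R != 0 by apply: contraNneq R'0 => ->; rewrite deriv0.
    by apply: leq_ltn_trans (lt_size_deriv R0); rewrite size_poly_gt0.
elim: s => [|R s IHs] /=; first by rewrite big_nil derivC coprimep0 eqpxx.
move=> /andP[Rs sU] sI; have [RI R'0] := sI R (mem_head _ _).
have {}sI R' : R' \in s -> normalized_irreducible R' /\ (uni0 R')^`() != 0.
  by move=> R's; apply: sI; rewrite inE R's orbT.
have {}IHs := IHs sU sI.
rewrite big_cons derivM; set G := \prod_(R <- s) uni0 R in IHs *.
have RG : coprimep (uni0 R) G.
  rewrite /G big_seq; apply: (big_ind (coprimep (uni0 R))) => [|x y|R' R's].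
  - exact: coprimep1.
  - by rewrite coprimepMr => -> ->.
  have [R'I _] := sI _ R's; have [//|[w wE]] := cop R (uni0 R') RI R'0.
  suff RR' : R = R' by rewrite RR' R's in Rs.
  apply: (normalized_irreducible_dvd RI R'I); exists (multi0 w).
  by rewrite -[LHS]uni0K wE rmorphM /= uni0K.
have RR' : coprimep (uni0 R) (uni0 R)^`().
  have [//|[w wE]] := cop R (uni0 R)^`() RI R'0.
  have w0 : w != 0 by apply: contraNneq R'0 => w0; rewrite wE w0 mulr0.
  have R0 : uni0 R != 0 by apply: contraNneq R'0 => ->; rewrite deriv0.
  have := lt_size_deriv R0; rewrite wE size_mul //.
  by rewrite -[size w]prednK ?size_poly_gt0 // addnS /= ltnNge leq_addr.
rewrite coprimepMl addrC; apply/andP; split.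
  by rewrite mulrC coprimep_addl_mul coprimepMr RR' RG.
by rewrite addrC coprimep_addl_mul coprimepMr coprimep_sym RG.
Qed.

Lemma homogeneous_euler n m (F : {mpoly C[n]}) v : homogeneous m F ->
  \sum_i F^`M(i).@[v] * v i = m%:R * F.@[v].
Proof.
move=> Fh; pose h i := v i *: 'X : {poly C}.
have K : mmap polyC h F = F.@[v] *: 'X^m.
  apply: poly_funext => t; rewrite horner_mmap hornerZ hornerXn mulrC -Fh.
  by apply: meval_eq => i; rewrite hornerZ hornerX mulrC.
have := congr1 (fun q : {poly C} => q^`().[1]) K.
rewrite derivZ derivXn hornerZ hornerMn hornerXn expr1n mulrC => <-.
rewrite deriv_mmap horner_sum; apply: eq_bigr => i _.
rewrite hornerM derivZ derivX hornerZ hornerC mulr1 horner_mmap; congr (_ * _).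
by apply: meval_eq => j; rewrite hornerZ hornerX mulr1.
Qed.

Lemma homogeneous_mderiv n m (F : {mpoly C[n]}) i t v : homogeneous m F ->
  t * F^`M(i).@[fun j => t * v j] = t ^+ m * F^`M(i).@[v].
Proof.
move=> Fh; pose h1 j := (v j)%:P + (j == i)%:R *: 'X : {poly C}.
pose h2 j := t *: h1 j.
have K : mmap polyC h2 F = t ^+ m *: mmap polyC h1 F.
  apply: poly_funext => x; rewrite hornerZ !horner_mmap -Fh.
  by apply: meval_eq => j; rewrite hornerZ.
have h1' j : (h1 j)^`() = (j == i)%:R%:P.
  by rewrite derivD derivC add0r derivZ derivX alg_polyC.
have h10 j : (h1 j).[0] = v j by rewrite hornerD hornerC hornerZ hornerX mulr0 addr0.
have := congr1 (fun q : {poly C} => q^`().[0]) K.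
rewrite derivZ hornerZ !deriv_mmap !horner_sum (bigD1 i) //=.
rewrite [in RHS](bigD1 i) //= big1 => [|j ji]; last first.
  by rewrite hornerM derivZ h1' (negPf ji) scaler0 horner0 mulr0.
rewrite [in RHS]big1 => [|j ji]; last by rewrite hornerM h1' (negPf ji) hornerC mulr0.
rewrite !addr0 !hornerM !horner_mmap derivZ hornerZ !h1' eqxx hornerC !mulr1 mulrC.
rewrite (meval_eq (v2 := fun j => t * v j)) => [->|j]; last by rewrite hornerZ h10.
by congr (_ * _); apply: meval_eq.
Qed.

Variable k : nat.
Implicit Types B : seq 'M[C]_k.

Lemma radical_homogeneous B : exists m, homogeneous m (radical B).
Proof.
have [_ fI fE] := factorsP B.
have [|m [mh _]] := @divisor_homogeneous C k B (radical B)
  (\prod_(Rt <- factors B) Rt.1 ^+ Rt.2.-1); last by exists m.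
rewrite fE /radical -big_split big_seq [RHS]big_seq /=; apply: eq_bigr => Rt /fI[_ _ R2].
by rewrite -exprS prednK.
Qed.

Lemma radical_e0 B : (radical B).@[@e0 C _] = 1.
Proof.
have [_ fI _] := factorsP B; rewrite /radical rmorph_prod big_seq big1 //.
by move=> Rt /fI[].
Qed.

(* A common root of the radical and its z_0-derivative over a direction d is
   excluded by their Bezout identity over C[z]; Euler's identity turns the
   z_0-derivative into the derivative along the line through d. *)
Lemma simple_along_generic B : exists2 Delta : {mpoly C[size B]}, Delta != 0 &
  forall d, Delta.@[d] != 0 -> simple_along (B := B) d.
Proof.
set F := radical B; have [fU fI fE] := factorsP B.
have cop : coprimep (uni0 F) (uni0 F)^`().
  have -> : uni0 F = \prod_(R <- [seq Rt.1 | Rt <- factors B]) uni0 R.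
    by rewrite /F /radical rmorph_prod big_map.
  apply: coprimep_prod_deriv => // _ /mapP[Rt fRt ->].
  have [RI R1 _] := fI _ fRt; split; first by split.
  have [m Rh m0] := factor_homogeneous fRt.
  exact: irreducible_deriv_neq0 m0 Rh R1.
have /Bezout_coprimepP[[a b] /eqpP[[c1 c2] /= /andP[_ c20] E]] := cop.
exists c2 => // d d0 t; rewrite rootE line_poly_horner => /eqP Ft.
have [m Fh] := radical_homogeneous B.
have t0 : t != 0.
  apply: contra_eq_neq Ft => ->; have := Fh (-1) (@e0 C _); rewrite radical_e0 mulr1.
  rewrite (meval_eq (v2 := affine_point (fun s => 0 * d s))) => [->|j].
    by rewrite expf_neq0 // oppr_eq0 oner_eq0.
  rewrite /affine_point /e0; case: (unliftP ord0 j) => [s|] -> /=.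
    by rewrite mul0r mulr0.
  by rewrite mulr1.
pose w (j : 'I_(size B).+1) := oapp d (- t^-1) (unlift ord0 j).
have tw : affine_point (fun s => t * d s) =1 (fun j => t * w j).
  move=> j; rewrite /affine_point /w; case: (unlift ord0 j) => [s|] //=.
  by rewrite mulrN divff.
pose h (j : 'I_(size B).+1) : {poly C} := oapp (fun s => (d s)%:P) 'X (unlift ord0 j).
have hw j : (h j).[- t^-1] = w j.
  by rewrite /h /w; case: (unlift _ _) => [s|] /=; rewrite ?hornerC ?hornerX.
pose G := map_poly (meval d) (uni0 F).
have GE : G = mmap polyC h F.
  apply: (mpoly_rmorph_ext (f := map_poly (meval d) \o @uni0 _ C)
    (g := mmap polyC h)) => [c|j] /=.
    by rewrite uni0C map_polyC /= mevalC mmapC.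
  rewrite mmapXU /h; case: (unliftP ord0 j) => [s|] ->.
    by rewrite uni0XS map_polyC /= mevalXU.
  by rewrite uni0X0 map_polyX.
have Gw : G.[- t^-1] = 0.
  have : t ^+ m * F.@[w] == 0 by rewrite -Fh -(meval_eq _ tw) Ft.
  rewrite mulf_eq0 expf_eq0 (negPf t0) andbF /= => /eqP.
  by rewrite GE horner_mmap => Fw; rewrite (meval_eq _ hw).
have G'w : F^`M(ord0).@[w] != 0.
  have -> : F^`M(ord0).@[w] = G^`().[- t^-1].
    rewrite GE deriv_mmap horner_sum big_ord_recl /= big1 => [|s _].
      by rewrite addr0 hornerM horner_mmap (meval_eq _ hw) /h unlift_none derivX hornerC mulr1.
    by rewrite /h liftK derivC mulr0 horner0.
  have := congr1 (fun q : {poly {mpoly C[size B]}} =>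
    (map_poly (meval d) q).[- t^-1]) E.
  rewrite /= -!mul_polyC.
  rewrite !rmorphM rmorphD !rmorphM !hornerM hornerD !hornerM -/G Gw mulr0 add0r.
  rewrite /= !map_polyC !hornerC /= meval1 mulr1 -deriv_map -/G => E'.
  by apply: contraNneq d0 => G'0; rewrite -E' G'0 mulr0 mulr0.
have Fv0 : F^`M(ord0).@[fun j => t * w j] != 0.
  have := homogeneous_mderiv ord0 t w Fh => /eqP; apply: contraTneq => ->.
  by rewrite mulr0 eq_sym mulf_neq0 // expf_neq0.
have := homogeneous_euler (fun j => t * w j) Fh.
rewrite -(meval_eq _ tw) Ft mulr0 big_ord_recl /= {2}/w unlift_none /= mulrN divff //.
rewrite mulrN1 addrC => /eqP; rewrite subr_eq0 => /eqP FE.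
apply: contraNneq Fv0 => H'; rewrite -FE.
have -> : \sum_s F^`M(lift ord0 s).@[fun j => t * w j] * (t * w (lift ord0 s)) =
   t * (line_poly d F)^`().[t]; last by rewrite H' mulr0.
rewrite deriv_mmap horner_sum mulr_sumr big_ord_recl /= unlift_none derivN derivC oppr0.
rewrite mulr0 horner0 mulr0 add0r; apply: eq_bigr => s _.
rewrite /w liftK hornerM derivZ derivX hornerZ hornerC mulr1 mulrCA; congr (_ * (_ * _)).
by rewrite -[RHS]/((line_poly d _).[t]) line_poly_horner (meval_eq _ tw).
Qed.

End SimpleDirections.

Section GenericMatrix.
Variable C : numClosedFieldType.

(* D is taken on the segment from the identity to the matrix all of whose rows
   are w, where Delta(w) <> 0.  Each condition is polynomial along this segment
   and holds at one of its two ends. *)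
Lemma generic_real_matrix N (Delta : {mpoly C[N]}) (Gamma : 'I_N -> {mpoly C[N]})
    (eps : C) :
  0 < eps -> Delta != 0 -> (forall i, (Gamma i).@[@axis C N i] != 0) ->
  exists D : 'M[C]_N, [/\ D \is a realmx, near_identity eps D, D \in unitmx &
    forall i, Delta.@[D i] != 0 /\ (Gamma i).@[D i] != 0].
Proof.
move=> eps0 D0 G0; have [w w0] := mpoly_nonroot D0.
pose h (i j : 'I_N) : {poly C} := (j == i)%:R%:P + ((w j)%:R - (j == i)%:R) *: 'X.
have hE i j t : (h i j).[t] = (j == i)%:R + ((w j)%:R - (j == i)%:R) * t.
  by rewrite hornerD hornerC hornerZ hornerX.
pose q := \det (\matrix_(i, j) h i j) *
  \prod_i (mmap polyC (h i) Delta * mmap polyC (h i) (Gamma i)).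
have nz (p : {poly C}) t : p.[t] != 0 -> p != 0.
  by apply: contraNneq => ->; rewrite horner0.
have q0 : q != 0.
  rewrite mulf_neq0 //; last first.
    apply/prodf_neq0 => i _; rewrite mulf_neq0 //.
      apply: (nz _ 1); rewrite horner_mmap (meval_eq (v2 := fun j => (w j)%:R)) // => j.
      by rewrite hE mulr1 addrC subrK.
    apply: (nz _ 0); rewrite horner_mmap (meval_eq (v2 := @axis C N i)) // => j.
    by rewrite hE mulr0 addr0.
  apply: (nz _ 0); rewrite -/(horner_eval 0 _) -det_map_mx.
  rewrite (_ : map_mx _ _ = 1%:M) ?det1 ?oner_neq0 //.
  by apply/matrixP => i j; rewrite !mxE /= /horner_eval hE mulr0 addr0 eq_sym.
pose K : C := \sum_j (w j)%:R + 2.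
have w_ge0 : 0 <= \sum_j (w j)%:R :> C by apply: sumr_ge0 => j _; apply: ler0n.
have K0 : 0 < K by rewrite ltr_wpDl // ltr0n.
pose f (i : nat) : C := eps / K / i.+1%:R.
have f_inj : injective f.
  move=> i j /(mulfI (mulf_neq0 (lt0r_neq0 eps0) (invr_neq0 (lt0r_neq0 K0)))) /invr_inj.
  by move/eqP; rewrite eqr_nat eqSS => /eqP.
have [i0 qf] := poly_nonroot f_inj q0; set s := f i0 in qf.
have s0 : 0 < s by rewrite !divr_gt0 // ltr0n.
have sK : s * K <= eps.
  rewrite /s /f mulrAC divfK ?lt0r_neq0 // ler_pdivrMr ?ltr0n //.
  by rewrite -[leLHS]mulr1 ler_pM2l // ler1n.
move: qf; rewrite hornerM horner_prod mulf_eq0 negb_or => /andP[qdet /prodf_neq0 qDG].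
pose D : 'M[C]_N := \matrix_(i, j) (h i j).[s].
exists D; split.
- apply/mxOverP => i j; rewrite mxE hE; have sR := gtr0_real s0.
  exact: realD (realn _ _) (realM (realB (realn _ _) (realn _ _)) sR).
- move=> i j; rewrite !mxE hE eq_sym addrC addKr normrM (gtr0_norm s0) mulrC.
  apply: lt_le_trans sK; rewrite ltr_pM2l //.
  apply: (@le_lt_trans _ _ ((w j)%:R + 1)).
    apply: (le_trans (ler_normB _ _)); rewrite normr_nat lerD2l normr_nat.
    by case: (_ == _); rewrite ?ler01.
  rewrite /K (bigD1 j) //= -addrA ltrD2l.
  by rewrite ltr_wpDl ?sumr_ge0 // ?ltr1n // => ? _; apply: ler0n.
- rewrite unitmxE unitfE (_ : \det D = (\det (\matrix_(i, j) h i j)).[s]) //.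
  rewrite -[RHS]/(horner_eval s _) -det_map_mx; congr (\det _).
  by apply/matrixP => i j; rewrite !mxE.
move=> i; have := qDG i isT; rewrite hornerM mulf_eq0 negb_or !horner_mmap.
have DE : (fun j => (h i j).[s]) =1 D i by move=> j; rewrite mxE.
by rewrite !(meval_eq _ DE) => /andP.
Qed.

End GenericMatrix.

Section LinearAction.
Variables (C : numClosedFieldType) (k : nat).
Implicit Types B : seq 'M[C]_k.

Lemma spectral_defect_le B Bt S : S \in unitmx ->
  (forall i : 'I_(size B), exists (e : 'I_(size Bt) -> C) (c : C),
     B`_i = invmx S *m (\sum_(s < size Bt) e s *: Bt`_s) *m S + c%:M) ->
  (spectral_defect Bt <= spectral_defect B)%N.
Proof.
move=> SU /boolp.choice[E /boolp.choice[c BE]].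
by have [] := spectral_defect_compare SU BE.
Qed.

Lemma size_lin_act B (D : 'M[C]_(size B)) : size (lin_act D) = size B.
Proof. by rewrite size_map size_enum_ord. Qed.

Lemma nth_lin_act B (D : 'M[C]_(size B)) (i : 'I_(size B)) :
  (lin_act D)`_i = \sum_(s < size B) D i s *: B`_s.
Proof. by rewrite (nth_map i) ?size_enum_ord // nth_ord_enum. Qed.

Lemma lin_act_inv B (D : 'M[C]_(size B)) (s : 'I_(size B)) : D \in unitmx ->
  B`_s = \sum_(i < size B) invmx D s i *: (lin_act D)`_i.
Proof.
move=> DU; under eq_bigr do rewrite nth_lin_act scaler_sumr.
rewrite exchange_big /= (bigD1 s) //= [X in _ + X]big1 => [|s' s's].
  rewrite addr0; under eq_bigr do rewrite scalerA.
  rewrite -scaler_suml; have := mulVmx DU => /matrixP/(_ s s).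
  by rewrite !mxE eqxx => ->; rewrite scale1r.
under eq_bigr do rewrite scalerA.
rewrite -scaler_suml; have := mulVmx DU => /matrixP/(_ s s').
by rewrite !mxE eq_sym (negPf s's) => ->; rewrite scale0r.
Qed.

Lemma spectral_defect_conj_lin_act B (D : 'M[C]_(size B)) S :
  D \in unitmx -> S \in unitmx ->
  spectral_defect [seq invmx S *m T *m S | T <- lin_act D] = spectral_defect B.
Proof.
move=> DU SU; set B' := map _ _.
have sB' : size B' = size B by rewrite size_map size_lin_act.
have B'E (i : 'I_(size B)) :
    B'`_i = invmx S *m (\sum_(s < size B) D i s *: B`_s) *m S.
  by rewrite (nth_map 0) ?size_lin_act // nth_lin_act.
apply/eqP; rewrite eqn_leq; apply/andP; split.
  apply: (spectral_defect_le (S := invmx S)); first by rewrite unitmx_inv.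
  move=> s; exists (fun i => invmx D s (cast_ord sB' i)), 0.
  rewrite raddf0 addr0 invmxK.
  rewrite (reindex (cast_ord (esym sB'))) /=; last first.
    by exists (cast_ord sB') => i _; apply: val_inj.
  rewrite (eq_bigr (fun i : 'I_(size B) =>
     invmx S *m (invmx D s i *: (lin_act D)`_i) *m S)); last first.
    move=> i _; rewrite (_ : cast_ord _ _ = i); last exact: val_inj.
    by rewrite /= B'E nth_lin_act -scalemxAr -scalemxAl.
  rewrite -mulmx_suml -mulmx_sumr -lin_act_inv // !mulmxA mulmxV // mul1mx.
  by rewrite -mulmxA mulmxV // mulmx1.
apply: (spectral_defect_le SU) => i.
exists (D (cast_ord sB' i)), 0; rewrite raddf0 addr0.
exact: (B'E (cast_ord sB' i)).
Qed.

Lemma admissible_conj_lin_act B (D : 'M[C]_(size B)) S :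
  D \in unitmx -> S \in unitmx -> (forall i, simple_along (B := B) (D i)) ->
  admissible [seq invmx S *m T *m S | T <- lin_act D].
Proof.
move=> DU SU DS; have defE := spectral_defect_conj_lin_act DU SU.
set B' := map _ _ in defE *.
have sB' : size B' = size B by rewrite size_map size_lin_act.
apply/admissibleP => i.
apply/(simple_along_compare (Bt := B) (d' := D (cast_ord sB' i))
  (E := fun j => D (cast_ord sB' j)) SU) => //.
- move=> j; rewrite (nth_map 0) ?size_lin_act -?sB' //.
  by rewrite -(nth_lin_act D (cast_ord sB' j)).
- move=> s; rewrite (bigD1 i) //= /axis eqxx mulr1 big1 ?addr0 // => j /negPf->.
  by rewrite mulr0.
Qed.

Lemma conj1_map B : [seq invmx 1%:M *m T *m 1%:M | T <- B] = B.
Proof. by rewrite -[RHS]map_id; apply: eq_map => T; rewrite invmx1 mul1mx mulmx1. Qed.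

Lemma spectral_defect_lin_act B (D : 'M[C]_(size B)) :
  D \in unitmx -> spectral_defect (lin_act D) = spectral_defect B.
Proof.
by move=> DU; rewrite -(spectral_defect_conj_lin_act DU (unitmx1 _ _)) conj1_map.
Qed.

Lemma exists_admissible_matrix B (eps : C) : 0 < eps ->
  exists D : 'M[C]_(size B), [/\ near_identity eps D, D \is a realmx, D \in unitmx,
    forall S, S \in unitmx -> admissible [seq invmx S *m T *m S | T <- lin_act D] &
    all [pred T | T \in unitmx] B -> all [pred T | T \in unitmx] (lin_act D)].
Proof.
move=> eps0; have [Delta Delta0 DeltaP] := simple_along_generic B.
pose g : {mpoly C[size B]} :=
  \det (\sum_(s < size B) 'X_s *: map_mx (@mpolyC (size B) C) B`_s).
have gE v : g.@[v] = \det (\sum_(s < size B) v s *: B`_s).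
  rewrite -det_map_mx; congr (\det _); apply/matrixP => a b.
  rewrite !mxE /= !summxE raddf_sum /=; apply: eq_bigr => s _.
  by rewrite !mxE mevalM mevalXU mevalC.
pose Gamma := if all [pred T | T \in unitmx] B then g else 1.
have [|D [DR Dnear DU DP]] :=
    @generic_real_matrix C (size B) Delta (fun=> Gamma) eps eps0 Delta0.
  move=> i; rewrite /Gamma; case: ifP => [/allP BU|_]; last by rewrite meval1 oner_neq0.
  rewrite gE (bigD1 i) //= /axis eqxx scale1r big1 ?addr0 => [|j /negPf->].
    by rewrite -unitfE -unitmxE; apply: BU; apply: mem_nth.
  by rewrite scale0r.
exists D; split=> // [S SU|BU].
  by apply: admissible_conj_lin_act => // i; apply: DeltaP; case: (DP i).
apply/allP => _ /mapP[i _ ->] /=; rewrite unitmxE unitfE -gE.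
by have [_] := DP i; rewrite /Gamma BU.
Qed.

Lemma exists_admissible_for B (eps : C) : 0 < eps ->
  exists D : 'M[C]_(size B), near_identity eps D /\ admissible_for D.
Proof.
move=> /(exists_admissible_matrix B)[D [Dn DR DU adm _]]; exists D; split=> //.
by split=> //; have := adm 1%:M (unitmx1 _ _); rewrite conj1_map.
Qed.

End LinearAction.

Section Adjoint.
Variables (C : numClosedFieldType) (k : nat).
Implicit Types (M T : 'M[C]_k) (B X : seq 'M[C]_k).

Lemma hermsymmxP M : reflect (M^t* = M) (M \is hermsymmx).
Proof.
apply: (iffP (is_hermitianmxP _ _ _)); rewrite expr0 scale1r.
  by move=> {2}->.
by move=> ->.
Qed.

Lemma adjoint_mul M T : (M *m T)^t* = T^t* *m M^t*.
Proof. by rewrite trmx_mul map_mxM. Qed.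

Lemma adjointZ (a : C) M : (a *: M)^t* = a^* *: M^t*.
Proof. by rewrite linearZ /= map_mxZ. Qed.

Lemma adjointD M T : (M + T)^t* = M^t* + T^t*.
Proof. by rewrite linearD /= map_mxD. Qed.

Lemma adjointB M T : (M - T)^t* = M^t* - T^t*.
Proof. by rewrite linearB /= map_mxB. Qed.

Lemma adjoint_hermitian M : (M^t* \is hermsymmx) = (M \is hermsymmx).
Proof.
by apply/hermsymmxP/hermsymmxP => h; [rewrite -[RHS]trmxCK h | rewrite trmxCK h].
Qed.

Lemma eigenprojection_adjoint M (a : C) : (eigenprojection M a)^t* = eigenprojection M a.
Proof.
set U := eigenspace M a; rewrite /eigenprojection -/U; set P := proj_ortho U.
have PP : P *m (1%:M - P)^t* = 0.
  apply/orthomx1P; rewrite orthomx_sym (eqmx_ortho _ (proj_orthoE U)).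
  by rewrite -{1}(mul1mx P); apply: proj_ortho_compl_sub.
have P_eq : P = P *m P^t*.
  apply/eqP; rewrite -subr_eq0 -{1}[P]mulmx1 -[1%:M]trmxCK trmx1 map_mx1.
  by rewrite -mulmxBr -adjointB PP.
by rewrite {1}P_eq adjoint_mul trmxCK.
Qed.

Lemma foldl_word_mul B (A W : 'M[C]_k) (s : seq (C * nat)) :
  let f := fun (W : 'M[C]_k) ji => W *m eigenprojection B`_0 ji.1 *m B`_ji.2 in
  foldl f (A *m W) s = A *m foldl f W s.
Proof. by elim: s W => //= x s IHs W; rewrite -IHs !mulmxA. Qed.

Lemma word_adjoint B i I J : hermitian_tuple B -> size J = size I ->
  (word B (i :: I) J)^t* = word B (rev (i :: I)) (rev J).
Proof.
move=> /allP Bh; have nthB j : (B`_j)^t* = B`_j.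
  have [jB|jB] := ltnP j (size B); last by rewrite nth_default // trmx0 map_mx0.
  by apply/hermsymmxP/Bh; apply: mem_nth.
elim/last_ind: I J => [|I a IHI] J.
  by move=> /size0nil ->; rewrite /word /= nthB.
case/lastP: J => [|J b]; first by rewrite size_rcons.
rewrite !size_rcons => -[sJ]; rewrite -rcons_cons !rev_rcons.
have -> : word B (rcons (i :: I) a) (rcons J b) =
    word B (i :: I) J *m eigenprojection B`_0 b *m B`_a.
  by rewrite /word /= zip_rcons // foldl_rcons.
rewrite !adjoint_mul nthB eigenprojection_adjoint IHI // rev_cons.
by case: (rev I) => [|a' I']; rewrite /word /= mulmxA -foldl_word_mul.
Qed.

Lemma words_adjoint B q : hermitian_tuple B ->
  perm_eq [seq T^t* | T <- words B q.+1] (words B q.+1).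
Proof.
move=> Bh; rewrite /words; set ev := distinct_eigenvalues _.
set Js := filter _ _; set Is := filter _ _.
pose g (s : q.+1.-tuple 'I_(size B)) (t : q.-tuple 'I_(size ev)) :=
  word B (map val s) [seq ev`_(val j) | j <- t].
have rev_inj n (T : eqType) : injective (fun s : n.-tuple T => [tuple of rev s]).
  by move=> s t /(congr1 val) /= /(can_inj (@revK _)) /val_inj.
have pI : perm_eq [seq [tuple of rev s] | s : q.+1.-tuple _ <- Is] Is.
  apply: uniq_perm; rewrite ?map_inj_uniq ?filter_uniq // -?enumT ?enum_uniq //.
    exact: rev_inj.
  move=> s; rewrite /Is mem_filter mem_enum andbT; apply/mapP/idP => [[s']|sI].
    by rewrite /Is mem_filter => /andP[+ _] -> /=; rewrite all_rev.
  exists [tuple of rev s]; last by apply: val_inj; rewrite /= revK.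
  by rewrite /Is mem_filter mem_enum /= all_rev sI.
have pJ : perm_eq [seq [tuple of rev t] | t : q.-tuple _ <- Js] Js.
  apply: uniq_perm; rewrite ?map_inj_uniq ?filter_uniq // -?enumT ?enum_uniq //.
    exact: rev_inj.
  move=> t; rewrite /Js mem_filter mem_enum andbT; apply/mapP/idP => [[t']|tJ].
    by rewrite /Js mem_filter => /andP[+ _] -> /=; rewrite rev_uniq.
  exists [tuple of rev t]; last by apply: val_inj; rewrite /= revK.
  by rewrite /Js mem_filter mem_enum /= rev_uniq tJ.
have -> : [seq T^t* | T <- [seq g s t | s <- Is, t <- Js]] =
    [seq g s t | s <- [seq [tuple of rev s] | s : q.+1.-tuple _ <- Is],
                 t <- [seq [tuple of rev t] | t : q.-tuple _ <- Js]].
  rewrite map_allpairs allpairs_mapl allpairs_mapr.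
  apply: eq_allpairs => s t; rewrite /g /= !map_rev.
  case: s => [[|i I] sI] //=; case: t => J sJ /=.
  rewrite -word_adjoint // !size_map.
  by rewrite (eqP sJ); move: sI; rewrite /= eqSS => /eqP.
exact: perm_allpairs.
Qed.

Lemma ext1_adjoint B : hermitian_tuple B ->
  perm_eq [seq T^t* | T <- ext1 B] (ext1 B).
Proof.
move=> Bh; rewrite /ext1 map_cat; apply: perm_cat.
  rewrite (_ : map _ B = B) //; rewrite -[RHS]map_id; apply/eq_in_map => T TB.
  by apply/hermsymmxP; apply: (allP Bh).
rewrite map_flatten -map_comp; set r := _.-1.
have : forall q, q \in iota 2 r -> (0 < q)%N by move=> q; rewrite mem_iota; case: q.
elim: (iota 2 r) => //= q qs IHqs q_gt0.
apply: perm_cat; last by apply: IHqs => q' q'qs; apply: q_gt0; rewrite inE q'qs orbT.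
by case: q q_gt0 => [/(_ 0%N (mem_head _ _))|q _] //; apply: words_adjoint.
Qed.

Lemma perm_eq_involution (T : eqType) (f : T -> T) (s : seq T) : involutive f ->
  (forall x, x \in s -> f x != x) -> perm_eq (map f s) s ->
  exists ts, perm_eq s (ts ++ map f ts).
Proof.
move=> fK; have [n] := ubnP (size s); elim: n s => // n IHn [|x s] /= le_n fx ps.
  by exists [::].
have fxs : f x \in s.
  have : f x \in x :: s by rewrite -(perm_mem ps) mem_head.
  by rewrite inE (negPf (fx x (mem_head _ _))).
have sE := perm_to_rem fxs; set s' := rem (f x) s in sE.
have [||| ts tsE] := IHn s'.
- by rewrite size_rem // (leq_ltn_trans (leq_pred _)).
- by move=> y ys'; apply: fx; rewrite inE (mem_rem ys') orbT.
- rewrite -(perm_cons x) -(perm_cons (f x)).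
  have : perm_eq (f x :: map f s) (f x :: x :: map f s').
    by rewrite perm_cons (perm_trans (perm_map f sE)) //= fK.
  rewrite perm_sym => /perm_trans; apply; apply: (perm_trans ps).
  rewrite perm_sym (perm_catCA [:: f x] [:: x] s') /=.
  by rewrite perm_cons perm_sym.
exists (x :: ts); rewrite /= perm_cons (perm_trans sE) // perm_sym.
rewrite (perm_catCA ts [:: f x] (map f ts)) /=.
by rewrite perm_cons perm_sym.
Qed.

Lemma exists_hermitization X : perm_eq [seq T^t* | T <- X] X ->
  exists H, hermitization X H.
Proof.
move=> pX; set NH := [seq T <- X | T \isn't hermsymmx].
have [|T||ts tsE] := @perm_eq_involution _ (fun T : 'M[C]_k => T^t*) NH.
- exact: trmxCK.
- by rewrite mem_filter => /andP[TN _]; apply: contraNneq TN => /hermsymmxP.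
- have -> : [seq T^t* | T <- NH] = [seq T <- [seq T^t* | T <- X] | T \isn't hermsymmx].
    rewrite filter_map; congr map; apply: eq_filter => T /=.
    by rewrite adjoint_hermitian.
  exact: perm_filter.
by eexists; exists ts.
Qed.

Lemma hermitization_hermitian X H : hermitization X H -> hermitian_tuple H.
Proof.
move=> [ts _ ->]; rewrite /hermitian_tuple all_cat filter_all /=.
apply/allP => T /flatten_mapP[U _]; rewrite !inE => /orP[]/eqP-> /=; apply/hermsymmxP.
  rewrite adjointZ adjointD trmxCK addrC; congr (_ *: _).
  by rewrite fmorphV rmorph_nat.
rewrite adjointZ adjointB trmxCK -opprB scalerN -scaleNr; congr (_ *: _).
by rewrite rmorphM /= conjCi fmorphV rmorph_nat mulNr opprK.
Qed.

End Adjoint.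

Section Span.
Variables (C : numClosedFieldType) (k : nat).
Implicit Types (T : 'M[C]_k) (B X H : seq 'M[C]_k).

Definition in_span H T : Prop :=
  exists e : 'I_(size H) -> C, T = \sum_(s < size H) e s *: H`_s.

Lemma in_span_mem H T : T \in H -> in_span H T.
Proof.
move=> TH; have sH : (index T H < size H)%N by rewrite index_mem.
exists (@axis C _ (Ordinal sH)).
rewrite (bigD1 (Ordinal sH)) //= /axis eqxx scale1r nth_index // big1 ?addr0 // => s.
by move=> /negPf->; rewrite scale0r.
Qed.

Lemma in_span_lin H (a b : C) T U :
  in_span H T -> in_span H U -> in_span H (a *: T + b *: U).
Proof.
move=> [e ->] [f ->]; exists (fun s => a * e s + b * f s).
rewrite !scaler_sumr -big_split; apply: eq_bigr => s _.
by rewrite scalerDl !scalerA.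
Qed.

Lemma spectral_defect_span B Bt : (forall T, T \in B -> in_span Bt T) ->
  (spectral_defect Bt <= spectral_defect B)%N.
Proof.
move=> BS; apply: (spectral_defect_le (S := 1%:M)) => [|i]; first exact: unitmx1.
have [e ->] := BS _ (mem_nth 0 (ltn_ord i)); exists e, 0.
by rewrite invmx1 mul1mx mulmx1 raddf0 addr0.
Qed.

Lemma spectral_defect_cat B X : (spectral_defect (B ++ X) <= spectral_defect B)%N.
Proof.
by apply: spectral_defect_span => T TB; apply: in_span_mem; rewrite mem_cat TB.
Qed.

Lemma spectral_defect_hermitization X H : hermitization X H ->
  (spectral_defect H <= spectral_defect X)%N.
Proof.
move=> [ts tsE HE]; apply: spectral_defect_span => T TX.
have [Th|Th] := boolP (T \is hermsymmx).
  by apply: in_span_mem; rewrite HE mem_cat mem_filter Th TX.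
have i2 : 'i * ('i / 2) = - 2^-1 :> C by rewrite mulrA -expr2 sqrCi mulN1r.
have two : 2^-1 + 2^-1 = 1 :> C by field.
have parts U : U \in ts -> in_span H U /\ in_span H (U^t*).
  move=> Uts; pose a := 2^-1 *: (U + U^t*); pose b := ('i / 2) *: (U - U^t*).
  have abH x : x \in [:: a; b] -> in_span H x.
    move=> xab; apply: in_span_mem; rewrite HE mem_cat; apply/orP; right.
    by apply/flatten_mapP; exists U.
  have [aH bH] : in_span H a /\ in_span H b by split; apply: abH; rewrite !inE eqxx ?orbT.
  have UE : U = 1 *: a + (- 'i) *: b.
    by rewrite /a /b !scalerA mulNr i2 opprK; apply/matrixP => i j; rewrite !mxE; field.
  have UE' : U^t* = 1 *: a + 'i *: b.
    by rewrite /a /b !scalerA i2; apply/matrixP => i j; rewrite !mxE; field.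
  by split; [rewrite UE|rewrite UE']; apply: in_span_lin.
have : T \in [seq T <- X | T \isn't hermsymmx] by rewrite mem_filter Th.
rewrite (perm_mem tsE) mem_cat => /orP[/parts[]//|/mapP[U /parts[_ +] ->]] //.
Qed.

End Span.

Section ReducibilityTest.
Variables (C : numClosedFieldType) (k : nat).
Implicit Types A B : seq 'M[C]_k.

Lemma hermitian_lin_act B (D : 'M[C]_(size B)) :
  hermitian_tuple B -> D \is a realmx -> hermitian_tuple (lin_act D).
Proof.
move=> /allP Bh /mxOverP DR; apply/allP => _ /mapP[i _ ->] /=; apply/hermsymmxP.
rewrite !raddf_sum /=; apply: eq_bigr => s _.
have /hermsymmxP BsE : B`_s \is hermsymmx by apply: Bh; apply: mem_nth.
by rewrite adjointZ BsE (CrealP (DR i s)).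
Qed.

Lemma steps_conclude_defect (eps : C) m B : 0 < eps -> (0 < m)%N ->
  hermitian_tuple B -> admissible B -> (spectral_defect B <= m)%N ->
  steps_conclude eps m B.
Proof.
move=> eps0; elim: m B => // m IHm B _ Bh Badm le_m.
have [rep|rep] := boolP (repeated_factors (ext1 B)); last by left; exists Irreducible.
have [st|st] := pselect (spectrally_stable B (ext1 B)); first by left; exists Reducible.
have lt_ext1 : (spectral_defect (ext1 B) < spectral_defect B)%N.
  rewrite ltn_neqAle spectral_defect_cat andbT; apply/eqP => defE.
  by apply: st; apply: spectrally_stable_of_defect.
have m0 : (0 < m)%N.
  rewrite repeated_factors_defect in rep.
  by rewrite -ltnS (leq_ltn_trans rep) ?(leq_trans lt_ext1).
right; split=> [|B' [H [Hherm [D [_ [DU Dadm DR] ->]]]]].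
  have [H Hherm] := exists_hermitization (ext1_adjoint Bh).
  have [D [Dnear Dadm]] := exists_admissible_for H eps0.
  by exists (lin_act D), H; split=> //; exists D.
have Hh := hermitization_hermitian Hherm.
apply: IHm => //; first exact: hermitian_lin_act (DR Hh).
rewrite spectral_defect_lin_act // -ltnS.
apply: leq_ltn_trans (spectral_defect_hermitization Hherm) _.
exact: leq_trans lt_ext1 le_m.
Qed.

Lemma size_shift A (c : 'I_(size A) -> C) : size (shift c) = size A.
Proof. by rewrite size_map size_enum_ord. Qed.

Lemma nth_shift A (c : 'I_(size A) -> C) (i : 'I_(size A)) :
  (shift c)`_i = A`_i + (c i)%:M.
Proof. by rewrite (nth_map i) ?size_enum_ord // nth_ord_enum. Qed.

Lemma spectral_defect_shift A (c : 'I_(size A) -> C) :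
  (spectral_defect (shift c) <= spectral_defect A)%N.
Proof.
apply: (spectral_defect_le (S := 1%:M)) => [|i]; first exact: unitmx1.
pose i' := cast_ord (esym (size_shift c)) i.
exists (axis C i'), (- c i); rewrite (bigD1 i') //= /axis eqxx scale1r big1 ?addr0.
  by rewrite nth_shift invmx1 mul1mx mulmx1 raddfN addrK.
by move=> s /negPf->; rewrite scale0r.
Qed.

Lemma spectral_defect_normalization A A' : normalization A A' ->
  (spectral_defect A' <= spectral_defect A)%N.
Proof.
move=> [_ [c [D [S [_ [DU _ _] SU ->]]]]].
by rewrite spectral_defect_conj_lin_act // spectral_defect_shift.
Qed.

Lemma exists_unit_shift (M : 'M[C]_k) : exists c : nat, M + c%:R%:M \in unitmx.
Proof.
have [c cP] := poly_nonroot (@natr_inj C) (monic_neq0 (char_poly_monic (- M))).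
exists c; rewrite unitmxE unitfE; apply: contraNN cP => /det0P[v v0 vM].
rewrite -/(root _ _) -eigenvalue_root_char; apply/eigenvalueP; exists v => //.
apply/eqP; rewrite mulmxN -subr_eq0 -opprD oppr_eq0 addrC.
by rewrite -mul_mx_scalar addrC -mulmxDr vM.
Qed.

Lemma exists_normalization A : (0 < size A)%N -> hermitian_tuple A ->
  exists A', normalization A A'.
Proof.
move=> sA Ah; have /boolp.choice[cn cU] : forall i : 'I_(size A), exists c : nat,
    A`_i + c%:R%:M \in unitmx by move=> i; apply: exists_unit_shift.
pose c i : C := (cn i)%:R; set B := shift c.
have BU : all [pred T | T \in unitmx] B by apply/allP => _ /mapP[i _ ->]; apply: cU.
have Bh : hermitian_tuple B.
  apply/allP => _ /mapP[i _ ->]; apply/hermsymmxP; rewrite adjointD tr_scalar_mx.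
  rewrite map_scalar_mx /= rmorph_nat; congr (_ + _); apply/hermsymmxP.
  by apply: (allP Ah); apply: mem_nth.
have [D [_ DR DU Dadm /(_ BU) LU]] := exists_admissible_matrix B ltr01.
have Lh := hermitian_lin_act Bh DR; set L := lin_act D in LU Lh.
have sL : (0 < size L)%N by rewrite size_lin_act size_shift.
set P := spectralmx L`_0; have PU : P \in unitmx := spectral_unit _.
have Pinv : invmx P = P^t* := invmx_unitary (spectral_unitarymx _).
exists [seq invmx (invmx P) *m T *m invmx P | T <- L]; split; last first.
  exists c, D, (invmx P); split=> // [i||]; rewrite ?unitmx_inv //.
    exact: realn.
  split=> //; have := Dadm 1%:M (unitmx1 _ _); by rewrite conj1_map.
split.
- apply/allP => _ /mapP[T TL ->]; apply/hermsymmxP.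
  rewrite invmxK Pinv !adjoint_mul trmxCK mulmxA.
  by have /hermsymmxP -> : T \is hermsymmx by apply: (allP Lh).
- by apply: Dadm; rewrite unitmx_inv.
- apply/allP => _ /mapP[T TL ->] /=.
  by rewrite !unitmx_mul !unitmx_inv PU andbT; apply: (allP LU).
have /hermitian_normalmx/orthomx_spectralP L0E : L`_0 \is hermsymmx.
  by apply: (allP Lh); apply: mem_nth.
by rewrite (nth_map 0) // invmxK L0E -/P !mulmxA mulmxV // mul1mx mulmxK.
Qed.

End ReducibilityTest.

Theorem theorem9p11 (R : realType) (k n : nat) (A : n.-tuple 'M[R[i]]_k)
    (n_ge2 : (2 <= n)%N) (hermA : hermitian_tuple A)
    (eps : R[i]) (eps_gt0 : 0 < eps) :
  reducibility_test_concludes eps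
    (spectral_multiplicity A - spectral_index A)%N A.
Proof.
split=> [|A' normA'].
  by apply: exists_normalization; rewrite // size_tuple (leq_trans _ n_ge2).
have [[hermA' admA' _ _] _] := normA'.
have [sc|sc] := boolP (strongly_connected A'); last by left; exists Reducible.
have [rep|rep] := boolP (repeated_factors A'); last first.
  by left; exists Irreducible; rewrite /= sc.
have le_def := spectral_defect_normalization normA'.
right; apply: steps_conclude_defect => //.
by apply: leq_trans le_def; rewrite -repeated_factors_defect.
Qed.
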